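(* Let $(X,d)=(X_1,d_1)\times(X_2,d_2)$ be a product of two proper Hadamard spaces with the standard product metric $d$, and let $G\subset Is(X_1)\times Is(X_2)$ be a group acting properly on $X$. Assume that $G$ contains two elements $g=(g_1,g_2)$ and $h=(h_1,h_2)$ such that, for each $i\in\{1,2\}$, $g_i$ and $h_i$ are independent rank one isometries of $X_i$, and that $\delta_\theta>0$ for every $\theta\in[0,\pi/2]$. Then there exists $\theta_\star\in(0,\pi/2)$ such that $\delta_{\theta_\star}=\max_{\theta\in[0,\pi/2]}\delta_\theta$.
   Context: A Hadamard space is a complete simply connected metric space of non-positive Alexandrov curvature (a complete CAT(0) space); it is proper if all balls of finite radius are compact. For $(X_1,d_1),(X_2,d_2)$ proper Hadamard spaces, $X=X_1\times X_2$ carries the metric $d=\sqrt{d_1^2+d_2^2}$; $Is(X_i)$ is the isometry group of $X_i$; $o=(o_1,o_2)\in X$ is a fixed base point. A group $G\subset Is(X_1)\times Is(X_2)$ acts properly on $X$ if $\{g\in G: d(x,gx)\le r\}$ is finite for all $x\in X$, $r>0$. An isometry of a Hadamard space is rank one if it acts as a translation on a geodesic axis which does not bound a flat half plane; it then fixes the two endpoints of its axis in the geometric boundary. Two rank one isometries are independent if their sets of fixed boundary endpoints are disjoint. For $g=(g_1,g_2)\in G$ with $go\ne o$ let $\theta(g)=\arctan\frac{d_2(o_2,g_2o_2)}{d_1(o_1,g_1o_1)}\in[0,\pi/2]$ (with value $\pi/2$ if the denominator is $0$). For $\theta\in[0,\pi/2]$, $\epsilon>0$, integer $n\ge1$, put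 $A_{\epsilon,\theta}(o,n)=\{g\in G: go\neq o,\ n-1\le d(o,go)<n,\ |\theta(g)-\theta|\le\epsilon\}$, $\delta_{\epsilon,\theta}=\limsup_{n\to\infty}\frac{\log|A_{\epsilon,\theta}(o,n)|}{n}$ (with $\log 0=-\infty$), and $\delta_\theta=\liminf_{\epsilon\to0}\delta_{\epsilon,\theta}\in[-\infty,\infty)$. The number $\delta_\theta$ is the growth rate of $G$ with slope $\theta$. *)

(* Defs.v *)
From mathcomp Require Import all_boot all_order all_algebra.
From mathcomp Require Import all_classical all_reals all_analysis.

Set Implicit Arguments.
Unset Strict Implicit.
Unset Printing Implicit Defensive.

Import Order.TTheory GRing.Theory Num.Theory.
Import numFieldNormedType.Exports.

Local Open Scope classical_set_scope.
Local Open Scope ring_scope.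

Definition plane_dist (R : realType) (p q : R * R) : R :=
  Num.sqrt ((p.1 - q.1) ^+ 2 + (p.2 - q.2) ^+ 2).

Definition plane_segment (R : realType) (p q : R * R) : set (R * R) :=
  [set ((1 - u) * p.1 + u * q.1, (1 - u) * p.2 + u * q.2) | u in `[0, 1]].

Definition isometry (R : realType) (X : metricType R) (f : X -> X) : Prop :=
  (forall x y, mdist (f x) (f y) = mdist x y) /\ (forall y, exists x, f x = y).

Definition geodesic_segment (R : realType) (X : metricType R)
    (c : R -> X) (l : R) (x y : X) : Prop :=
  [/\ 0 <= l, c 0 = x, c l = y &
      forall s t, 0 <= s <= l -> 0 <= t <= l -> mdist (c s) (c t) = `|s - t|].

Definition geodesic_line (R : realType) (X : metricType R) (c : R -> X) :
  Prop := forall s t, mdist (c s) (c t) = `|s - t|.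

(* Only the values of [c] at nonnegative times matter. *)
Definition geodesic_ray (R : realType) (X : metricType R) (c : R -> X) :
  Prop := forall s t, 0 <= s -> 0 <= t -> mdist (c s) (c t) = `|s - t|.

Definition geodesic_space (R : realType) (X : metricType R) : Prop :=
  forall x y : X, exists c l, geodesic_segment c l x y.

(* The triangle with vertices [p, q, r] has sides [c1, c2, c3], and
   [p', q', r'] is its comparison triangle. The points [c1 s] and [c2 t] lie on
   the two sides issuing from [p], and [x', y'] are their comparison points.
   The vertices being arbitrary, this covers any two distinct sides (and two
   points on the same side are always at their comparison distance). *)
Definition CAT0_inequality (R : realType) (X : metricType R) : Prop :=
  forall (p q r : X) (c1 c2 c3 : R -> X) (l1 l2 l3 : R) (p' q' r' : R * R),
    geodesic_segment c1 l1 p q ->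
    geodesic_segment c2 l2 p r ->
    geodesic_segment c3 l3 q r ->
    plane_dist p' q' = l1 -> plane_dist p' r' = l2 -> plane_dist q' r' = l3 ->
  forall (s t : R) (x' y' : R * R),
    0 <= s <= l1 -> 0 <= t <= l2 ->
    plane_segment p' q' x' -> plane_dist p' x' = s ->
    plane_segment p' r' y' -> plane_dist p' y' = t ->
    mdist (c1 s) (c2 t) <= plane_dist x' y'.

Definition complete_space (R : realType) (X : metricType R) : Prop :=
  forall F : set_system X, ProperFilter F -> cauchy F ->
    exists x : X, F --> x.

Definition Hadamard (R : realType) (X : metricType R) : Prop :=
  [/\ complete_space X, geodesic_space X & CAT0_inequality X].

Definition proper_space (R : realType) (X : metricType R) : Prop :=
  forall (x : X) (r : R), compact [set y | mdist x y <= r].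

Definition asymptotic (R : realType) (X : metricType R) (c c' : R -> X) :
  Prop := exists K : R, forall t, 0 <= t -> mdist (c t) (c' t) <= K.

(* A point of the geometric boundary is an asymptoty class of geodesic rays;
   this is the class of the ray [c]. *)
Definition endpoint (R : realType) (X : metricType R) (c : R -> X) :
  set (R -> X) := [set c' | geodesic_ray c' /\ asymptotic c c'].

Definition axis (R : realType) (X : metricType R) (f : X -> X) (c : R -> X) :
  Prop :=
  geodesic_line c /\ exists2 l : R, 0 < l & forall t, f (c t) = c (t + l).

Definition bounds_flat_half_plane (R : realType) (X : metricType R)
    (c : R -> X) : Prop :=
  exists F : R * R -> X,
    (forall p q, 0 <= p.2 -> 0 <= q.2 -> mdist (F p) (F q) = plane_dist p q) /\
    (forall t, F (t, 0) = c t).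

Definition rank_one (R : realType) (X : metricType R) (f : X -> X) : Prop :=
  isometry f /\ exists2 c, axis f c & ~ bounds_flat_half_plane c.

(* All axes of [f] are parallel, so this set has exactly two elements as soon
   as [f] has an axis. *)
Definition axis_endpoints (R : realType) (X : metricType R) (f : X -> X) :
  set (set (R -> X)) :=
  [set xi | exists2 c, axis f c &
              xi = endpoint c \/ xi = endpoint (fun t => c (- t))].

Definition independent_rank_one (R : realType) (X : metricType R)
    (f h : X -> X) : Prop :=
  [/\ rank_one f, rank_one h & axis_endpoints f `&` axis_endpoints h = set0].

(* The canonical metric of [X1 * X2] in the library is the maximum metric. *)
Definition product_dist (R : realType) (X1 X2 : metricType R)
    (x y : X1 * X2) : R :=
  Num.sqrt (mdist x.1 y.1 ^+ 2 + mdist x.2 y.2 ^+ 2).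

Definition act (X1 X2 : Type) (g : (X1 -> X1) * (X2 -> X2)) (x : X1 * X2) :
  X1 * X2 := (g.1 x.1, g.2 x.2).

Definition isometry_subgroup (R : realType) (X1 X2 : metricType R)
    (G : set ((X1 -> X1) * (X2 -> X2))) : Prop :=
  [/\ forall g, G g -> isometry g.1 /\ isometry g.2,
      G (idfun, idfun),
      forall g h, G g -> G h -> G (g.1 \o h.1, g.2 \o h.2) &
      forall g, G g -> exists2 h, G h &
        [/\ cancel g.1 h.1, cancel h.1 g.1, cancel g.2 h.2 & cancel h.2 g.2]].

Definition acts_properly (R : realType) (X1 X2 : metricType R)
    (G : set ((X1 -> X1) * (X2 -> X2))) : Prop :=
  forall (x : X1 * X2) (r : R), 0 < r ->
    finite_set [set g | G g /\ product_dist x (act g x) <= r].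

Definition slope (R : realType) (X1 X2 : metricType R) (o : X1 * X2)
    (g : (X1 -> X1) * (X2 -> X2)) : R :=
  if mdist o.1 (g.1 o.1) == 0 then pi / 2
  else atan (mdist o.2 (g.2 o.2) / mdist o.1 (g.1 o.1)).

Definition orbit_annulus (R : realType) (X1 X2 : metricType R)
    (G : set ((X1 -> X1) * (X2 -> X2))) (o : X1 * X2) (eps theta : R)
    (n : nat) : set ((X1 -> X1) * (X2 -> X2)) :=
  [set g | [/\ G g, act g o <> o,
               n%:R - 1 <= product_dist o (act g o) < n%:R &
               `|slope o g - theta| <= eps]].

(* [lne 0 = -oo]; the term of index 0 is irrelevant for the limit superior. *)
Definition growth_rate_eps (R : realType) (X1 X2 : metricType R)
    (G : set ((X1 -> X1) * (X2 -> X2))) (o : X1 * X2) (eps theta : R) :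
  \bar R :=
  limn_esup (fun n : nat =>
    (lne (counting (orbit_annulus G o eps theta n)) * (n%:R^-1)%:E)%E).

Definition growth_rate (R : realType) (X1 X2 : metricType R)
    (G : set ((X1 -> X1) * (X2 -> X2))) (o : X1 * X2) (theta : R) : \bar R :=
  limf_einf (fun eps : R => growth_rate_eps G o eps theta) 0^'+.

(* Main.v *)
From mathcomp Require Import all_boot all_order all_algebra.
From mathcomp Require Import all_classical all_reals all_analysis.
From mathcomp Require Import ring lra.
Require Import Defs.

Set Implicit Arguments.
Unset Strict Implicit.
Unset Printing Implicit Defensive.

Import Order.TTheory GRing.Theory Num.Theory.
Import numFieldNormedType.Exports.

Local Open Scope classical_set_scope.
Local Open Scope ring_scope.

(** The counting function of [G] is concave along directions. Write an element
    [g] of [G] as the vector [(d1 g, d2 g)] of its two displacements of the base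
    point. If [S] and [W] are finite subsets of [G] whose vectors are close to
    [v] and [v'], then the products [s lam w], for a suitable [lam] out of a fixed
    finite set, have vectors close to [v + v'], and there are about [#|S| #|W|]
    of them. Taking words made of [p] letters of slope about [0] and [q] letters of
    slope about [pi / 2] gives
      [delta_theta >= cos theta * delta_0 + sin theta * delta_(pi/2)]
    for every interior [theta] (lemma [growth_concave]). On the other hand
    [theta |-> delta_theta] is upper semicontinuous, so that it attains its
    maximum on the compact interval (lemma [growth_rate_attains_max]). If the
    maximum [M] is attained at an endpoint and the value [m] at the other endpoint
    is positive, then in the direction of the vector [(M, m)], or [(m, M)], the
    right-hand side above is the length of this vector, which exceeds [M]; an
    infinite [M] only makes this easier.

    The geometry is in the existence of the finite set of the elements [lam]
    (theorem [generic_product]): whatever [x] and [y] are, some [lam] makes both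
    geodesics [[x_i, lam y_i]] pass near the base point. Passing near makes
    displacements almost additive, and it bounds the fibres of
    [(s, w) |-> s lam w]: the point [s o] lies near the geodesic from [o] to
    [s lam w o], at a distance of [o] that is known up to a constant, so that
    properness leaves boundedly many candidates for [s].

    The elements [lam] come from one fact about the axis [c] of a rank one
    isometry (theorem [passes_near]): if the nearest points on [c] to [x] and
    to [y] are far apart, then the geodesic [[x, y]] passes near every point of
    [c] in between. Two arguments prove it, both with limits along an
    ultrafilter in a proper space and both moved back to a fixed part of [c] by
    powers of the isometry.
    - If the distances to points [x_i] become affine along [c] with a slope
      [k] such that [|k| < 1], then the geodesics from the points of [c] to [x_i]
      converge to rays that fill a flat half plane
      ([affine_limit_half_plane]). So on an axis without flat half plane the
      distance to a point [x] grows with slope close to [1] away from the nearest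
      point ([eventually_steep]), and the lines parallel to [c] stay at bounded
      distance ([parallel_bounded]).
    - If geodesics [[x_i, y_i]], with nearest points farther and farther away on
      both sides of [c 0], all avoided a large ball around [c 0], then moving [x_i]
      and [y_i] towards [c] would give geodesics that come close to the boundary
      of this ball without entering it. Their limit is a line parallel to [c] and
      too far from it.

    Curvature enters only through the inequality of Bruhat and Tits,
    [CN_inequality]. *)

(** * The inequality of Bruhat and Tits *)

Section CAT0.
Variables (R : realType) (X : metricType R).
Implicit Types x y z p q : X.

Definition divides (u : R) x y z :=
  mdist x z = u * mdist x y /\ mdist z y = (1 - u) * mdist x y.

Definition CN_inequality := forall x y z p (u : R), 0 <= u <= 1 ->
  divides u x y z ->
  mdist p z ^+ 2 <= (1 - u) * mdist p x ^+ 2 + u * mdist p y ^+ 2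
                    - u * (1 - u) * mdist x y ^+ 2.

Lemma mdist_lip x y z : `|mdist x y - mdist x z| <= mdist y z.
Proof.
rewrite ler_norml; have := metric_triangle x y z; have := metric_triangle x z y.
by rewrite (metric_sym z y) => ? ?; apply/andP; split; lra.
Qed.

Lemma plane_dist_sqr (p q : R * R) :
  plane_dist p q ^+ 2 = (p.1 - q.1) ^+ 2 + (p.2 - q.2) ^+ 2.
Proof. by rewrite sqr_sqrtr// addr_ge0// sqr_ge0. Qed.

Lemma plane_dist_eq (p q : R * R) (l : R) : 0 <= l ->
  (p.1 - q.1) ^+ 2 + (p.2 - q.2) ^+ 2 = l ^+ 2 -> plane_dist p q = l.
Proof. by move=> l0 e; rewrite /plane_dist e sqrtr_sqr ger0_norm. Qed.

Lemma geodesic_segment_length (c : R -> X) l x y :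
  geodesic_segment c l x y -> l = mdist x y.
Proof.
move=> [l0 <- <- h]; rewrite h ?lexx ?l0//.
by rewrite sub0r normrN ger0_norm.
Qed.

Lemma geodesic_segment_divides (c : R -> X) l x y u : 0 <= u <= 1 ->
  geodesic_segment c l x y -> divides u x y (c (u * l)).
Proof.
move=> /andP[u0 u1] g; rewrite /divides -(geodesic_segment_length g).
case: g => l0 <- <- h.
have ul : 0 <= u * l <= l by rewrite mulr_ge0//= ler_piMl.
rewrite !h ?lexx ?l0// sub0r normrN ger0_norm ?mulr_ge0//; split=> //.
rewrite distrC ger0_norm; first by ring.
by rewrite subr_ge0; case/andP: ul.
Qed.

(** The comparison triangle is placed with [x] at the origin and [y] on the first
    axis, and the comparison inequality is used for the vertex [p] itself. The
    right-hand side is what Stewart's theorem gives in the plane. *)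
Lemma comparison_point_bound (c : R -> X) l x y p u : geodesic_space X ->
  CAT0_inequality X -> 0 <= u <= 1 -> geodesic_segment c l x y ->
  mdist p (c (u * l)) ^+ 2 <=
  (1 - u) * mdist p x ^+ 2 + u * mdist p y ^+ 2 - u * (1 - u) * l ^+ 2.
Proof.
move=> hg hC /andP[u0 u1] g.
have lE := geodesic_segment_length g; have [l0 c0 cl _] := g.
have [l00|lp] := eqVneq l 0.
  move: (lE); rewrite l00 => /esym/mdist_positivity xy.
  by rewrite mulr0 c0 -xy expr0n/= mulr0 subr0 -mulrDl subrK mul1r.
have {}lp : 0 < l by rewrite lt_neqAle eq_sym lp.
have [c2 [l2 g2]] := hg x p; have [c3 [l3 g3]] := hg y p.
have l2E := geodesic_segment_length g2; have l3E := geodesic_segment_length g3.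
have [l20 _ c2l _] := g2; have [l30 _ _ _] := g3.
have t1 := metric_triangle x p y; have t2 := metric_triangle y x p.
have t3 := metric_triangle x y p.
rewrite (metric_sym p y) (metric_sym y x) -lE -l2E -l3E in t1 t2 t3.
(* The law of cosines gives the first coordinate of the third vertex. *)
pose a := (l ^+ 2 + l2 ^+ 2 - l3 ^+ 2) / (2 * l).
have aE : 2 * l * a = l ^+ 2 + l2 ^+ 2 - l3 ^+ 2.
  by rewrite /a mulrC divfK// mulf_neq0// gt_eqF.
have b0 : 0 <= l2 ^+ 2 - a ^+ 2.
  have h1 : a <= l2.
    rewrite -(ler_pM2l (_ : 0 < 2 * l)) ?mulr_gt0// aE.
    by nra.
  have h2 : - l2 <= a.
    rewrite -(ler_pM2l (_ : 0 < 2 * l)) ?mulr_gt0// aE.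
    by nra.
  by nra.
pose r' := (a, Num.sqrt (l2 ^+ 2 - a ^+ 2)).
have bE := sqr_sqrtr b0.
have ul : 0 <= u * l <= l by rewrite mulr_ge0//= ler_piMl.
have e1 : plane_dist (0, 0) (l, 0) = l by apply: plane_dist_eq => //=; ring.
have e2 : plane_dist (0, 0) r' = l2.
  by apply: plane_dist_eq => //=; rewrite !sub0r !sqrrN bE; ring.
have e3 : plane_dist (l, 0) r' = l3.
  apply: plane_dist_eq => //=; rewrite sub0r sqrrN bE.
  by rewrite sqrrB -mulrnAr -mulr_natl mulrCA mulrA aE; ring.
have s1 : plane_segment (0, 0) (l, 0) (u * l, 0).
  by exists u; rewrite /= ?in_itv/= ?u0//; congr (_, _); ring.
have s2 : plane_segment (0, 0) r' r'.
  exists 1; rewrite /= ?in_itv/= ?ler01 ?lexx//.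
  by rewrite subrr !mul0r !mul1r !add0r.
have e4 : plane_dist (0, 0) (u * l, 0) = u * l.
  by apply: plane_dist_eq; rewrite ?mulr_ge0//=; ring.
have l2l : 0 <= l2 <= l2 by rewrite l20 lexx.
have := hC _ _ _ _ _ _ _ _ _ _ _ _ g g2 g3 e1 e2 e3 _ _ _ _ ul l2l s1 e4 s2 e2.
rewrite c2l metric_sym => h.
have : mdist p (c (u * l)) ^+ 2 <= plane_dist (u * l, 0) r' ^+ 2.
  by rewrite ler_pXn2r// ?nnegrE ?mdist_ge0 ?sqrtr_ge0.
move=> /le_trans; apply.
rewrite plane_dist_sqr/= sub0r sqrrN bE !(metric_sym p) -l2E -l3E.
have -> : (u * l - a) ^+ 2 + (l2 ^+ 2 - a ^+ 2) =
  u ^+ 2 * l ^+ 2 - u * (2 * l * a) + l2 ^+ 2 by ring.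
by rewrite aE le_eqVlt; apply/orP; left; apply/eqP; ring.
Qed.

(** The comparison inequality bounds distances to the points of a chosen geodesic
    segment; applied with [p := z] it shows that any point dividing [[x, y]] in
    the ratio [u] is the point of that segment. *)
Lemma CAT0_CN : geodesic_space X -> CAT0_inequality X -> CN_inequality.
Proof.
move=> hg hC x y z p u u01 [xz zy].
have [c [l g]] := hg x y.
suff -> : z = c (u * l).
  by rewrite -(geodesic_segment_length g); exact: comparison_point_bound.
apply: mdist_positivity.
have := comparison_point_bound z hg hC u01 g.
rewrite (metric_sym z x) xz zy -(geodesic_segment_length g).
have -> : (1 - u) * (u * l) ^+ 2 + u * ((1 - u) * l) ^+ 2
   - u * (1 - u) * l ^+ 2 = 0 by ring.
by move=> h; apply/eqP; rewrite -sqrf_eq0 eq_le h sqr_ge0.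
Qed.

End CAT0.

(** * Convexity of the distance *)

Lemma half01 (R : realType) : 0 <= (2^-1 : R) <= 1.
Proof. by rewrite invr_ge0 ler0n invf_le1 ?ler1n. Qed.

Section Convexity.
Variable R : realType.

Definition convexR (f : R -> R) := forall a b u, 0 <= u <= 1 ->
  f ((1 - u) * a + u * b) <= (1 - u) * f a + u * f b.

Lemma convexR_chord f a b c : convexR f -> a < b -> b < c ->
  f b * (c - a) <= f a * (c - b) + f c * (b - a).
Proof.
move=> cf ab bc; have ac : 0 < c - a by lra.
pose u := (b - a) / (c - a).
have uE : u * (c - a) = b - a by rewrite /u divfK// gt_eqF.
have u01 : 0 <= u <= 1.
  by rewrite /u divr_ge0 ?ler_pdivrMr//=; lra.
have := cf a c u u01.
have -> : (1 - u) * a + u * c = a + u * (c - a) by ring.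
rewrite uE addrC subrK => h.
rewrite -(ler_pM2r ac) in h; apply: (le_trans h).
have -> : ((1 - u) * f a + u * f c) * (c - a) =
  f a * ((c - a) - u * (c - a)) + f c * (u * (c - a)) by ring.
by rewrite uE le_eqVlt; apply/orP; left; apply/eqP; ring.
Qed.

Lemma convexR_slope f p q r w : convexR f -> p < q -> q <= r -> r < w ->
  (f q - f p) * (w - r) <= (f w - f r) * (q - p).
Proof.
move=> cf pq; rewrite le_eqVlt => /predU1P[<-|qr] rw.
  have := convexR_chord cf pq rw; nra.
have h1 := convexR_chord cf pq qr; have h2 := convexR_chord cf qr rw.
have a0 : 0 < q - p by lra. have b0 : 0 < r - q by lra.
have c0 : 0 < w - r by lra.
rewrite -(ler_pM2r b0).
set A := f q - f p; set B := f r - f q; set C := f w - f r.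
have k1 : A * (r - q) <= B * (q - p) by rewrite /A /B; nra.
have k2 : B * (w - r) <= C * (r - q) by rewrite /C /B; nra.
have := ler_wpM2r (ltW c0) k1; have := ler_wpM2r (ltW a0) k2.
nra.
Qed.

(** The chord from [a] through [b] reaches arbitrarily far, where [f] is still at
    most [K]. *)
Lemma convexR_bounded_const f K : convexR f -> (forall t, 0 <= f t <= K) ->
  forall a b, f a = f b.
Proof.
move=> cf bf; suff H a b : f b <= f a.
  by move=> a b; apply/eqP; rewrite eq_le !H.
apply/ler_addgt0Pr => e e0.
have K0 : 0 <= K by have /andP[h1 h2] := bf 0; lra.
pose u := e / (K + e).
have u0 : 0 < u by rewrite divr_gt0//; lra.
have uK : u * (K + e) = e by rewrite /u divfK// gt_eqF//; lra.
have u01 : 0 <= u <= 1.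
  by rewrite (ltW u0)/= /u ler_pdivrMr ?mul1r//; lra.
have := cf a (a + (b - a) / u) u u01.
have -> : (1 - u) * a + u * (a + (b - a) / u) = b.
  by rewrite mulrDr mulrCA divff ?gt_eqF//; ring.
have /andP[_] := bf (a + (b - a) / u); have /andP[] := bf a.
move: (f _) (f a) (f b) => x y z; nra.
Qed.

End Convexity.

Section HadamardGeometry.
Variables (R : realType) (X : metricType R).
Hypothesis CN : CN_inequality X.
Hypothesis geo : geodesic_space X.
Implicit Types x y z p q : X.

Lemma divides_exists x y (u : R) : 0 <= u <= 1 -> exists z, divides u x y z.
Proof.
by move=> u01; have [c [l g]] := geo x y; exists (c (u * l));
  exact: geodesic_segment_divides.
Qed.

Lemma divides_sym (u : R) x y z : divides u x y z -> divides (1 - u) y x z.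
Proof.
by move=> [xz zy]; split; rewrite metric_sym (metric_sym y x) ?zy ?xz//; ring.
Qed.

Lemma divides_uniq (u : R) x y z w : 0 <= u <= 1 ->
  divides u x y z -> divides u x y w -> z = w.
Proof.
move=> u01 [xz zy] /(CN z u01).
rewrite (metric_sym z x) xz zy.
have -> : (1 - u) * (u * mdist x y) ^+ 2 + u * ((1 - u) * mdist x y) ^+ 2
   - u * (1 - u) * mdist x y ^+ 2 = 0 by ring.
move=> h; apply: mdist_positivity; apply/eqP.
by rewrite -sqrf_eq0 eq_le h sqr_ge0.
Qed.

Lemma between_divides x y z : mdist x z + mdist z y = mdist x y ->
  exists2 u : R, 0 <= u <= 1 & divides u x y z.
Proof.
move=> e; have z1 := mdist_ge0 x z; have z2 := mdist_ge0 z y.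
have [d0|d0] := eqVneq (mdist x y) 0.
  exists 0; first by lra.
  by rewrite /divides d0 !mulr0; split; lra.
have {}d0 : 0 < mdist x y by rewrite lt_neqAle eq_sym d0 mdist_ge0.
exists (mdist x z / mdist x y).
  by rewrite divr_ge0 ?ler_pdivrMr ?mul1r//=; lra.
by rewrite /divides mulrBl mul1r divfK ?gt_eqF//; split; lra.
Qed.

Lemma point_at_distance x y (r : R) : 0 <= r <= mdist x y ->
  exists z, mdist x z = r /\ mdist z y = mdist x y - r.
Proof.
move=> r0; have [c [l g]] := geo x y.
have lE := geodesic_segment_length g; rewrite -lE in r0 *.
case: g => l0 <- <- h; exists (c r); rewrite !h ?lexx ?l0//; split.
  by rewrite sub0r normrN ger0_norm//; case/andP: r0.
by rewrite distrC ger0_norm// subr_ge0; case/andP: r0.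
Qed.

(** Two applications of the CN inequality; the terms in the lengths of the two
    sides from [o] cancel. *)
Lemma convex_apex (u : R) (o a b a' b' : X) : 0 <= u <= 1 ->
  divides u o a a' -> divides u o b b' -> mdist a' b' <= u * mdist a b.
Proof.
move=> /andP[u0 u1] da db; have u01 : 0 <= u <= 1 by rewrite u0.
have h1 := CN a' u01 db; have h2 := CN b u01 da.
case: da => ea _; rewrite (metric_sym a' o) ea in h1.
rewrite (metric_sym a' b) in h1; rewrite (metric_sym b o) (metric_sym b a) in h2.
have : mdist a' b' ^+ 2 <= (u * mdist a b) ^+ 2.
  have := ler_wpM2l u0 h2; move: h1; set A := mdist _ _ ^+ 2 ; nra.
by rewrite ler_pXn2r// nnegrE ?mulr_ge0 ?mdist_ge0.
Qed.

(** The diagonal from [x] to [y'] cuts the quadrilateral into two triangles with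
    an apex. *)
Lemma convex_dist (u : R) (x x' y y' a b : X) : 0 <= u <= 1 ->
  divides u x x' a -> divides u y y' b ->
  mdist a b <= (1 - u) * mdist x y + u * mdist x' y'.
Proof.
move=> u01 da db; have [z dz] := divides_exists x y' u01.
have h1 := convex_apex u01 da dz.
have u01' : 0 <= 1 - u <= 1 by lra.
have h2 := convex_apex u01' (divides_sym dz) (divides_sym db).
have := metric_triangle a z b; lra.
Qed.

(** Geodesics are unique, so that two points between [x] and [y] lie on one
    segment. *)
Lemma between_same x y z w :
  mdist x z + mdist z y = mdist x y -> mdist x w + mdist w y = mdist x y ->
  mdist z w = `|mdist x z - mdist x w|.
Proof.
wlog le : z w / mdist x z <= mdist x w.
  move=> H ez ew; have [h|h] := leP (mdist x z) (mdist x w); first exact: H.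
  by rewrite metric_sym distrC; apply: H => //; exact: ltW.
move=> ez ew.
have [|v [xv vw]] := @point_at_distance x w (mdist x z).
  by rewrite mdist_ge0.
have ev : mdist x v + mdist v y = mdist x y.
  by have := metric_triangle x v y; have := metric_triangle v w y; lra.
have [u u01 du] := between_divides ez.
suff -> : z = v by rewrite vw xv ler0_norm; [ring|lra].
apply: (divides_uniq u01 du); case: du => e1 e2.
by rewrite /divides xv; split=> //; lra.
Qed.

Lemma line_divides (c : R -> X) a b (u : R) : geodesic_line c ->
  0 <= u <= 1 -> divides u (c a) (c b) (c ((1 - u) * a + u * b)).
Proof.
move=> lc /andP[u0 u1]; rewrite /divides !lc.
have -> : a - ((1 - u) * a + u * b) = u * (a - b) by ring.
have -> : (1 - u) * a + u * b - b = (1 - u) * (a - b) by ring.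
by rewrite !normrM (ger0_norm u0) (@ger0_norm _ (1 - u)) ?subr_ge0.
Qed.

Lemma convexR_dist_line (c : R -> X) x : geodesic_line c ->
  convexR (fun t => mdist x (c t)).
Proof.
move=> lc a b u u01.
have dx : divides u x x x by rewrite /divides mdistxx !mulr0.
exact: convex_dist u01 dx (line_divides a b lc u01).
Qed.

Lemma convexR_dist_lines (c s : R -> X) v : geodesic_line c -> geodesic_line s ->
  convexR (fun t => mdist (c t) (s (v + t))).
Proof.
move=> lc ls a b u u01.
have := convex_dist u01 (line_divides a b lc u01)
  (line_divides (v + a) (v + b) ls u01).
by have -> : (1 - u) * (v + a) + u * (v + b) = v + ((1 - u) * a + u * b) by ring.
Qed.

Lemma midpoint_CN (c : R -> X) p t u : geodesic_line c ->
  mdist p (c t) ^+ 2 <=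
  (mdist p (c (t - u)) ^+ 2 + mdist p (c (t + u)) ^+ 2) / 2 - u ^+ 2.
Proof.
move=> lc; have h := half01 R.
have := CN p h (line_divides (t - u) (t + u) lc h).
have -> : (1 - 2^-1) * (t - u) + 2^-1 * (t + u) = t by field.
rewrite lc real_normK ?num_real// => /le_trans; apply.
by rewrite le_eqVlt; apply/orP; left; apply/eqP; field.
Qed.

(** The midpoint of the diagonal [[a, c]] is joined to [b] and to [e]. *)
Lemma parallelogram (a b c e : X) :
  mdist a c ^+ 2 + mdist b e ^+ 2 <=
  mdist a b ^+ 2 + mdist b c ^+ 2 + mdist c e ^+ 2 + mdist e a ^+ 2.
Proof.
have h := half01 R.
have [m dm] := divides_exists a c h.
have h1 := CN b h dm; have h2 := CN e h dm.
have t := metric_triangle b m e; rewrite (metric_sym m e) in t.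
rewrite (metric_sym a b) (metric_sym c e).
have p0 := mdist_ge0 b e; have p1 := mdist_ge0 b m; have p2 := mdist_ge0 e m.
have : mdist b e ^+ 2 <= 2 * mdist b m ^+ 2 + 2 * mdist e m ^+ 2.
  have : mdist b e ^+ 2 <= (mdist b m + mdist e m) ^+ 2.
    by rewrite ler_pXn2r// nnegrE ?addr_ge0.
  have := sqr_ge0 (mdist b m - mdist e m); nra.
lra.
Qed.

Definition nearest (c : R -> X) x s := forall t, mdist x (c s) <= mdist x (c t).

(** The distance to [x] exceeds its value at [0] outside of a compact interval. *)
Lemma nearest_exists (c : R -> X) x : geodesic_line c -> exists s, nearest c x s.
Proof.
move=> lc; pose f t := mdist x (c t).
have lip t s : `|f t - f s| <= `|t - s| by rewrite -lc; exact: mdist_lip.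
have cf : continuous f.
  move=> t; apply/cvgrPdist_le => e e0; near=> s.
  apply: (le_trans (lip t s)); near: s.
  by apply: cvgr_dist_le => //; exact: cvg_id.
pose D := f 0; have D0 : 0 <= D by exact: mdist_ge0.
have [|s sI hs] := @EVT_min R f (- (2 * D)) (2 * D) _
  (continuous_subspaceT cf); first by lra.
exists s => t; have [tI|] := boolP (t \in `[- (2 * D), 2 * D]); first exact: hs.
rewrite in_itv/= -ler_norml -ltNge => tD.
have f0 : f s <= D by apply: hs; rewrite in_itv/= oppr_le0 mulr_ge0.
have := metric_triangle (c t) x (c 0); rewrite lc subr0 (metric_sym _ x).
rewrite -/(f t) -/(f s) -/(f 0) -/D => ?; apply: (le_trans f0); lra.
Unshelve. all: by end_near. Qed.

End HadamardGeometry.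

(** * Ultralimits and flat half planes *)

Section UltraLimit.
Variables (R : realType) (X : metricType R) (U : set_system nat).
Context {UU : UltraFilter U}.

Definition ulimit (f : nat -> X) (z : X) :=
  forall e : R, 0 < e -> \forall i \near U, mdist z (f i) < e.

Lemma ulimit_exists (f : nat -> X) z0 (r : R) : proper_space X ->
  (\forall i \near U, mdist z0 (f i) <= r) -> exists z, ulimit f z.
Proof.
move=> pX fr.
have [z [_ clz]] := pX z0 r _ (fmap_proper_filter f _) fr.
exists z => e e0; have [//|Uc] := in_ultra_setVsetC [set i | mdist z (f i) < e] UU.
have [|y [/= h1 h2]] := clz [set y | ~ mdist z y < e] (ball z e) Uc.
  exact: nbhsx_ballx.
by move: h2; rewrite ballEmdist.
Qed.

Lemma ulimit_cst z : ulimit (fun=> z) z.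
Proof. by move=> e e0; apply: nearW => i; rewrite mdistxx. Qed.

Lemma ulimit_dist f g z w : ulimit f z -> ulimit g w ->
  (fun i => mdist (f i) (g i)) @ U --> mdist z w.
Proof.
move=> fz gw; apply/cvgrPdist_lt => e e0.
have e2 : 0 < e / 2 by rewrite divr_gt0.
near=> i.
have h1 : mdist z (f i) < e / 2 by near: i; exact: fz.
have h2 : mdist w (g i) < e / 2 by near: i; exact: gw.
rewrite [ltRHS]splitr; apply: le_lt_trans (ltrD h1 h2).
have := mdist_lip z w (g i); have := mdist_lip (g i) z (f i).
rewrite (metric_sym (g i) z) (metric_sym (g i) (f i)) => ? ?.
have -> : mdist z w - mdist (f i) (g i) =
 (mdist z (g i) - mdist (f i) (g i)) + (mdist z w - mdist z (g i)) by ring.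
by apply: (le_trans (ler_normD _ _)); exact: lerD.
Unshelve. all: by end_near. Qed.

Lemma ulimit_dist_ge f z p r : ulimit f z ->
  (\forall i \near U, r <= mdist p (f i)) -> r <= mdist p z.
Proof.
move=> fz h; have := ulimit_dist (ulimit_cst p) fz.
by move=> /cvgr_to_ge; apply.
Qed.

Lemma ulimit_dist_le f z p r : ulimit f z ->
  (\forall i \near U, mdist p (f i) <= r) -> mdist p z <= r.
Proof.
move=> fz h; have := ulimit_dist (ulimit_cst p) fz.
by move=> /cvgr_to_le; apply.
Qed.

End UltraLimit.

Section HalfPlane.
Variables (R : realType) (X : metricType R).
Hypothesis CN : CN_inequality X.
Hypothesis geo : geodesic_space X.
Hypothesis pX : proper_space X.
Variables (U : set_system nat) (c : R -> X) (x : nat -> X) (k : R).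
Context {UU : UltraFilter U}.
Hypothesis lc : geodesic_line c.
Hypothesis k1 : -1 < k < 1.
Hypothesis hx : forall t,
  (fun i => mdist (x i) (c t) - mdist (x i) (c 0)) @ U --> k * t.

Lemma dist_diverges t M : \forall i \near U, M <= mdist (x i) (c t).
Proof.
have /andP[k0 k2] := k1.
pose s : R := (2 * `|M| + 2 * `|t| + 1) / (1 - k).
have sE : (1 - k) * s = 2 * `|M| + 2 * `|t| + 1.
  by rewrite /s mulrC divfK// gt_eqF// subr_gt0.
have /cvgrPdist_lt hs := @hx s.
near=> i.
have : `|k * s - (mdist (x i) (c s) - mdist (x i) (c 0))| < 1.
  by near: i; exact: hs.
have := metric_triangle (c s) (x i) (c 0); rewrite lc subr0 (metric_sym (c s)).
have := metric_triangle (x i) (c t) (c 0); rewrite lc subr0.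
rewrite ltr_norml => h1 h2 /andP[h3 h4].
have h5 := ler_norm s; have h6 := ler_norm M; nra.
Unshelve. all: by end_near. Qed.

Lemma dist_inv_cvg t : (fun i => (mdist (x i) (c t))^-1) @ U --> 0.
Proof.
apply/cvgrPdist_le => e e0; near=> i.
have h : e^-1 <= mdist (x i) (c t) by near: i; exact: dist_diverges.
have d0 : 0 < mdist (x i) (c t) by apply: lt_le_trans h; rewrite invr_gt0.
rewrite sub0r normrN ger0_norm ?invr_ge0 ?mdist_ge0//.
by rewrite -[leRHS]invrK lef_pV2// posrE invr_gt0.
Unshelve. all: by end_near. Qed.

(** The squared distance of the points [(t - k h, w h)] and [(s - k h', w h')] of
    the plane, where [w] is the square root of [1 - k ^+ 2]: the ray with base
    [c t] is meant to make the angle of cosine [- k] with [c]. *)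
Let skew_sqr t h s h' : R := (s - t) ^+ 2 + (h - h') ^+ 2 + 2 * k * (h - h') * (s - t).

Lemma ray_points : exists Z : nat -> R -> R -> X, forall i t h,
  0 <= h <= mdist (x i) (c t) ->
  mdist (c t) (Z i t h) = h /\ mdist (Z i t h) (x i) = mdist (x i) (c t) - h.
Proof.
have H (a : nat * R * R) : exists z,
  0 <= a.2 <= mdist (x a.1.1) (c a.1.2) ->
  mdist (c a.1.2) z = a.2 /\ mdist z (x a.1.1) = mdist (x a.1.1) (c a.1.2) - a.2.
  have [h|h] := pselect (0 <= a.2 <= mdist (x a.1.1) (c a.1.2)); last by exists (c 0).
  rewrite metric_sym in h.
  have [z zE] := point_at_distance geo h; exists z => _.
  by rewrite (metric_sym (x _)).
have [Z HZ] := choice H.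
by exists (fun i t h => Z (i, t, h)) => i t h; exact: (HZ (i, t, h)).
Qed.

(** Two CN inequalities bound the distance of points on two geodesics that end
    at [y]. The bound is written in terms of [Ds - Dt] and of the inverses of [Dt]
    and [Ds], which have limits when [y] goes to infinity. *)
Lemma ray_bound a b y (t s h h' : R) :
  let Dt := mdist y (c t) in let Ds := mdist y (c s) in
  0 <= h <= Dt -> 0 <= h' <= Ds -> 0 < Dt -> 0 < Ds ->
  mdist (c t) a = h -> mdist a y = Dt - h ->
  mdist (c s) b = h' -> mdist b y = Ds - h' ->
  mdist a b ^+ 2 <= (1 - h * Dt^-1) * (1 - h' * Ds^-1) * (s - t) ^+ 2 +
   (h * (1 + (Ds - Dt) * Dt^-1) - h') *
   ((Ds - Dt) - h' + ((Ds - Dt) + h) * (1 - (Ds - Dt) * Ds^-1)).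
Proof.
move=> Dt Ds /andP[h0 hD] /andP[h'0 h'D] Dt0 Ds0 ta ay sb yb.
pose u := h / Dt; pose v := h' / Ds.
have u01 : 0 <= u <= 1.
  apply/andP; split; first by rewrite /u divr_ge0 ?mdist_ge0.
  by rewrite /u ler_pdivrMr// mul1r.
have v01 : 0 <= v <= 1.
  apply/andP; split; first by rewrite /v divr_ge0 ?mdist_ge0.
  by rewrite /v ler_pdivrMr// mul1r.
have uD : u * Dt = h by rewrite /u divfK// gt_eqF.
have vD : v * Ds = h' by rewrite /v divfK// gt_eqF.
have da : divides u (c t) y a.
  rewrite /divides (metric_sym (c t) y) -/Dt ta ay uD mulrBl uD mul1r.
  by split.
have db : divides v (c s) y b.
  rewrite /divides (metric_sym (c s) y) -/Ds sb yb vD mulrBl vD mul1r.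
  by split.
have i1 := CN a v01 db; have i2 := CN (c s) u01 da.
rewrite (metric_sym (c s) y) -/Ds ay (metric_sym a (c s)) in i1.
rewrite (metric_sym (c s) y) (metric_sym (c t) y) -/Ds -/Dt lc real_normK ?num_real// in i2.
have v1 : 0 <= 1 - v by lra.
have i3 := ler_wpM2l v1 i2.
apply: le_trans (_ : (1 - v) * ((1 - u) * (s - t) ^+ 2 + u * Ds ^+ 2 -
        u * (1 - u) * Dt ^+ 2) + v * (Dt - h) ^+ 2 - v * (1 - v) * Ds ^+ 2 <= _).
  by apply: (le_trans i1); rewrite lerD2r lerD2r.
rewrite -!/u -!/v le_eqVlt; apply/orP; left; apply/eqP.
have -> : (1 - v) * ((1 - u) * (s - t) ^+ 2 + u * Ds ^+ 2 - u * (1 - u) * Dt ^+ 2)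
  + v * (Dt - h) ^+ 2 - v * (1 - v) * Ds ^+ 2 = (1 - u) * (1 - v) * (s - t) ^+ 2
  + ((1 - v) * (u * Ds ^+ 2 - u * (1 - u) * Dt ^+ 2) + v * (Dt - h) ^+ 2
  - v * (1 - v) * Ds ^+ 2) by ring.
by congr (_ + _); rewrite /u /v; field; rewrite !gt_eqF.
Qed.


Lemma limit_rays : exists F : R -> R -> X,
  (forall t h, 0 <= h -> mdist (c t) (F t h) = h) /\
  (forall t h s h', 0 <= h -> 0 <= h' ->
     mdist (F t h) (F s h') ^+ 2 <= skew_sqr t h s h').
Proof.
have [Z HZ] := ray_points.
have near_t t h : 0 <= h ->
    \forall i \near U, 0 <= h <= mdist (x i) (c t) /\ 0 < mdist (x i) (c t).
  move=> h0; near=> i; have : h + 1 <= mdist (x i) (c t).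
    by near: i; exact: dist_diverges.
  by rewrite h0; split; [apply/andP; split=> //|]; lra.
have H (a : R * R) : exists z, 0 <= a.2 -> ulimit U (fun i => Z i a.1 a.2) z.
  have [a0|a0] := boolP (0 <= a.2); last by exists (c 0).
  have [|z hz] := @ulimit_exists _ _ U _ (fun i => Z i a.1 a.2) (c a.1) a.2 pX.
    by apply: filterS (near_t a.1 _ a0) => i [hi _]; have [-> _] := HZ _ _ _ hi.
  by exists z.
have [F HF] := choice H.
have {}HF t h : 0 <= h -> ulimit U (fun i => Z i t h) (F (t, h)) by exact: (HF (t, h)).
exists (fun t h => F (t, h)); split=> [t h h0|t h s h' h0 h'0].
  apply/eqP; rewrite eq_le; apply/andP; split.
    apply: (ulimit_dist_le (HF t h h0)).
    by apply: filterS (near_t t _ h0) => i [hi _]; have [-> _] := HZ _ _ _ hi.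
  apply: (ulimit_dist_ge (HF t h h0)).
  by apply: filterS (near_t t _ h0) => i [hi _]; have [-> _] := HZ _ _ _ hi.
pose D t i := mdist (x i) (c t).
pose e i := D s i - D t i.
have ce : e @ U --> k * (s - t).
  have -> : k * (s - t) = k * s - k * t by ring.
  have -> : e = (fun i => (D s i - D 0 i) - (D t i - D 0 i)).
    by apply/funext => i; rewrite /e; ring.
  by apply: cvgB; exact: hx.
pose B i := (1 - h * (D t i)^-1) * (1 - h' * (D s i)^-1) * (s - t) ^+ 2 +
   (h * (1 + e i * (D t i)^-1) - h') *
   (e i - h' + (e i + h) * (1 - e i * (D s i)^-1)).
have cB : B @ U --> skew_sqr t h s h'.
  have -> : skew_sqr t h s h' = (1 - h * 0) * (1 - h' * 0) * (s - t) ^+ 2 +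
   (h * (1 + (k * (s - t)) * 0) - h') *
   (k * (s - t) - h' + (k * (s - t) + h) * (1 - (k * (s - t)) * 0)).
    by rewrite /skew_sqr; ring.
  have it := dist_inv_cvg t; have js := dist_inv_cvg s.
  have cc (r : R) : (fun=> r) @ U --> r by exact: cvg_cst.
  apply: cvgD.
    apply: cvgM (cc _); apply: cvgM.
      by apply: cvgB (cc _) _; apply: cvgM (cc _) it.
    by apply: cvgB (cc _) _; apply: cvgM (cc _) js.
  apply: cvgM.
    apply: cvgB _ (cc _); apply: cvgM (cc _) _; apply: cvgD (cc _) _.
    exact: cvgM ce it.
  apply: cvgD; first by apply: cvgB ce (cc _).
  apply: cvgM; first by apply: cvgD ce (cc _).
  by apply: cvgB (cc _) _; apply: cvgM ce js.
have cd := @ulimit_dist _ _ U UU _ _ _ _ (HF t h h0) (HF s h' h'0).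
have cd2 : (fun i => mdist (Z i t h) (Z i s h') ^+ 2) @ U -->
    mdist (F (t, h)) (F (s, h')) ^+ 2.
  by rewrite expr2; under eq_fun do rewrite expr2; exact: (cvgM cd cd).
apply: (ler_cvg_to cd2 cB); near=> i.
have [hi1 hi2] : 0 <= h <= D t i /\ 0 < D t i by near: i; exact: near_t.
have [hi3 hi4] : 0 <= h' <= D s i /\ 0 < D s i by near: i; exact: near_t.
have [z1 z2] := HZ _ _ _ hi1; have [z3 z4] := HZ _ _ _ hi3.
exact: (ray_bound hi1 hi3 hi2 hi4 z1 z2 z3 z4).
Unshelve. all: by end_near. Qed.

Section RayDistances.
Variable F : R -> R -> X.
Hypothesis F0 : forall t h, 0 <= h -> mdist (c t) (F t h) = h.
Hypothesis FE : forall t h s h', 0 <= h -> 0 <= h' ->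
     mdist (F t h) (F s h') ^+ 2 <= skew_sqr t h s h'.

Lemma ray_start t : F t 0 = c t.
Proof. by apply/esym/mdist_positivity; rewrite F0. Qed.

Lemma skew_sqr_ge0 t h s h' : 0 <= skew_sqr t h s h'.
Proof.
have /andP[k0 k2] := k1.
have -> : skew_sqr t h s h' = (1 + k) / 2 * (s - t + (h - h')) ^+ 2 +
  (1 - k) / 2 * (s - t - (h - h')) ^+ 2 by rewrite /skew_sqr; field.
by rewrite addr_ge0// mulr_ge0 ?sqr_ge0// divr_ge0//; lra.
Qed.

(** As a function of [t], the difference between the squared distance from [F s h]
    to [c t] and [t ^+ 2] is convex by the CN inequality. It is at most an affine
    function and agrees with it at [t = s], hence everywhere. *)
Lemma ray_dist_base t s h : 0 <= h -> mdist (c t) (F s h) ^+ 2 = skew_sqr t 0 s h.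
Proof.
move=> h0; apply/eqP; rewrite eq_le; apply/andP; split.
  by rewrite -ray_start; exact: FE.
have m := midpoint_CN CN (F s h) s (s - t) lc.
have b := FE (s + (s - t)) s (lexx 0) h0; rewrite ray_start in b.
rewrite !(metric_sym (F s h)) F0// in m.
have ts : s - (s - t) = t by ring.
rewrite ts in m.
move: m b; rewrite /skew_sqr; move: (mdist _ _ ^+ 2) (mdist _ _ ^+ 2) => A B.
nra.
Qed.

(** The line through the two points of the plane meets the boundary line at the
    position [w] of a third point, for which both distances are known. *)
Lemma ray_dist_oblique t h s h' : 0 <= h -> h < h' ->
  skew_sqr t h s h' <= mdist (F t h) (F s h') ^+ 2.
Proof.
move=> h0 hh'; have h'0 : 0 < h' by exact: le_lt_trans hh'.
pose m := h / h'; have mE : m * h' = h by rewrite /m divfK// gt_eqF.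
have m0 : 0 <= m by rewrite /m divr_ge0// ltW.
have m1 : m < 1 by rewrite /m ltr_pdivrMr// mul1r.
clearbody m; have m1' : 0 < 1 - m by rewrite subr_gt0.
pose w := (t - m * s) / (1 - m).
have wE : (1 - m) * w = t - m * s by rewrite /w mulrC divfK// gt_eqF.
pose N := Num.sqrt (skew_sqr t h s h').
have N2 : N ^+ 2 = skew_sqr t h s h' by rewrite sqr_sqrtr ?skew_sqr_ge0.
have N0 : 0 <= N by exact: sqrtr_ge0.
have q1 : (1 - m) * mdist (c w) (F s h') = N.
  apply/eqP; rewrite -(@eqrXn2 _ 2)// ?mulr_ge0 ?mdist_ge0 ?(ltW m1')//.
  rewrite N2 exprMn ray_dist_base ?(ltW h'0)//.
  rewrite /skew_sqr; apply/eqP.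
  have -> : (1 - m) ^+ 2 * ((s - w) ^+ 2 + (0 - h') ^+ 2 + 2 * k * (0 - h') * (s - w))
    = ((1 - m) * s - (1 - m) * w) ^+ 2 + (m * h' - h') ^+ 2 +
      2 * k * (m * h' - h') * ((1 - m) * s - (1 - m) * w) by ring.
  by rewrite wE mE; ring.
have q2 : (1 - m) * mdist (c w) (F t h) = m * N.
  apply/eqP; rewrite -(@eqrXn2 _ 2)// ?mulr_ge0 ?mdist_ge0 ?(ltW m1')//.
  rewrite !exprMn N2 ray_dist_base//.
  rewrite /skew_sqr; apply/eqP.
  have -> : (1 - m) ^+ 2 * ((t - w) ^+ 2 + (0 - h) ^+ 2 + 2 * k * (0 - h) * (t - w))
    = ((1 - m) * t - (1 - m) * w) ^+ 2 + ((1 - m) * h) ^+ 2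
      - 2 * k * ((1 - m) * h) * ((1 - m) * t - (1 - m) * w) by ring.
  by rewrite wE -mE; ring.
rewrite -N2 ler_pXn2r// ?nnegrE ?mdist_ge0//.
have := metric_triangle (c w) (F t h) (F s h') => tr.
rewrite -(ler_pM2l m1').
have := ler_wpM2l (ltW m1') tr; nra.
Qed.

(** A line at constant height does not meet the boundary; the point [F s h] is
    approximated by [F s (h + n)]. *)
Lemma ray_dist_level t s h : 0 <= h -> `|s - t| <= mdist (F t h) (F s h).
Proof.
move=> h0; apply/ler_addgt0Pr => e e0.
pose n := e / 2; have n0 : 0 < n by rewrite divr_gt0.
have hn : h < h + n by rewrite ltrDl.
have h1 : mdist (F s h) (F s (h + n)) <= n.
  rewrite -(ler_pXn2r (_ : (0 < 2)%N)) ?nnegrE ?mdist_ge0 ?(ltW n0)//.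
  apply: (le_trans (FE _ _ h0 _)); first by rewrite addr_ge0// ltW.
  by rewrite /skew_sqr le_eqVlt; apply/orP; left; apply/eqP; ring.
have h2 : `|s - t| - n <= mdist (F t h) (F s (h + n)).
  have [a0|a0] := leP (`|s - t| - n) 0.
    by apply: (le_trans a0); exact: mdist_ge0.
  rewrite -(ler_pXn2r (_ : (0 < 2)%N)) ?nnegrE ?mdist_ge0 ?(ltW a0)//.
  apply: le_trans (ray_dist_oblique _ _ h0 hn); rewrite /skew_sqr.
  rewrite -[(s - t) ^+ 2]real_normK ?num_real//.
  have /andP[ka kb] := k1.
  have h3 : k * (s - t) <= `|s - t|.
    apply: (le_trans (ler_norm _)); rewrite normrM ler_piMl// ler_norml.
    by apply/andP; split; lra.
  have := ler_wpM2l (ltW n0) h3; move: (`|s - t|) => A h4.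
  have -> : A ^+ 2 + (h - (h + n)) ^+ 2 + 2 * k * (h - (h + n)) * (s - t) =
    A ^+ 2 + n ^+ 2 - 2 * (n * (k * (s - t))) by ring.
  have -> : (A - n) ^+ 2 = A ^+ 2 + n ^+ 2 - 2 * (n * A) by ring.
  lra.
have := metric_triangle (F t h) (F s h) (F s (h + n)).
rewrite /n in h1 h2 *; lra.
Qed.

Lemma ray_dist t h s h' : 0 <= h -> 0 <= h' ->
  mdist (F t h) (F s h') ^+ 2 = skew_sqr t h s h'.
Proof.
move=> h0 h'0; apply/eqP; rewrite eq_le FE//=.
have [hh|hh|hh] := ltgtP h h'; first exact: ray_dist_oblique.
  rewrite metric_sym; apply: le_trans (ray_dist_oblique _ _ h'0 hh).
  by rewrite /skew_sqr le_eqVlt; apply/orP; left; apply/eqP; ring.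
rewrite -hh; apply: (@le_trans _ _ (`|s - t| ^+ 2)).
  by rewrite real_normK ?num_real// /skew_sqr le_eqVlt; apply/orP; left; apply/eqP; ring.
by rewrite ler_pXn2r ?nnegrE ?mdist_ge0//; exact: ray_dist_level.
Qed.

End RayDistances.

(** When [x i] goes to infinity and the Busemann function of its limit is affine
    on [c] of slope [k], the rays towards the limit make a constant angle with
    [c]. They span a flat half plane because [k] is neither [1] nor [-1]. *)
Theorem affine_limit_half_plane : bounds_flat_half_plane c.
Proof.
have [F [F0 FE]] := limit_rays.
have /andP[ka kb] := k1.
pose w := Num.sqrt (1 - k ^+ 2).
have w2 : w ^+ 2 = 1 - k ^+ 2 by rewrite sqr_sqrtr//; nra.
have w0 : 0 < w by rewrite sqrtr_gt0; nra.
exists (fun p => F (p.1 + k * (p.2 / w)) (p.2 / w)); split=> [p q p0 q0|t]; last first.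
  by rewrite /= mul0r mulr0 addr0; exact: ray_start.
apply/eqP; rewrite -(@eqrXn2 _ 2)// ?mdist_ge0 ?sqrtr_ge0//.
rewrite plane_dist_sqr ray_dist ?divr_ge0 ?(ltW w0)//; apply/eqP; rewrite /skew_sqr.
have pE : p.2 = w * (p.2 / w) by rewrite mulrC divfK// gt_eqF.
have qE : q.2 = w * (q.2 / w) by rewrite mulrC divfK// gt_eqF.
rewrite [in RHS]pE [in RHS]qE -mulrBr exprMn w2; ring.
Qed.

End HalfPlane.

(** * Distance to a point along a line without flat half plane *)

Lemma ultrafilter_at_infinity : exists U : set_system nat,
  UltraFilter U /\ forall n : nat, U [set m | (n <= m)%N].
Proof.
have [U [UU sU]] := @ultraFilterLemma nat \oo _.
by exists U; split=> // n; apply: sU; exists n.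
Qed.

Lemma nat_above (R : realType) (a : R) : exists n : nat, a <= n%:R.
Proof.
exists (Num.truncn `|a|).+1; apply: (le_trans (ler_norm a)); apply: ltW.
exact: truncnS_gt.
Qed.

Section Line.
Variables (R : realType) (X : metricType R).
Implicit Types (c : R -> X) (x : X) (a b s t l : R).

(** What the translations along an axis give: some [b] in any interval of length
    [l] can be moved to the origin of the parametrization. The map is not asked to
    be onto, since only distances between images are compared. *)
Definition recentering (c : R -> X) (l : R) := forall a, exists b psi,
  [/\ a <= b <= a + l, forall x y, mdist (psi x) (psi y) = mdist x y &
      forall t, psi (c (t + b)) = c t].

Definition reversed (c : R -> X) : R -> X := fun t => c (- t).

Lemma geodesic_line_rev c : geodesic_line c -> geodesic_line (reversed c).
Proof. by move=> lc s t; rewrite lc opprK addrC distrC. Qed.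

Lemma recentering_rev c l : recentering c l -> recentering (reversed c) l.
Proof.
move=> rc a; have [b [psi [/andP[b1 b2] h1 h2]]] := rc (- a - l).
exists (- b), psi; split=> //; first by apply/andP; split; lra.
by move=> t; rewrite /reversed -[RHS]h2; congr (psi (c _)); ring.
Qed.

Lemma bounds_flat_half_plane_rev c :
  bounds_flat_half_plane (reversed c) -> bounds_flat_half_plane c.
Proof.
move=> [F [F1 F2]]; exists (fun p => F (- p.1, p.2)); split=> [p q p0 q0|t].
  rewrite F1// /plane_dist /=; congr (Num.sqrt _); ring.
by rewrite F2 /reversed opprK.
Qed.

Lemma nearest_rev c x s : nearest c x s -> nearest (reversed c) x (- s).
Proof. by move=> h t; rewrite /reversed opprK; exact: h. Qed.

Lemma nearest_recenter c x s b (psi : X -> X) :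
  (forall x y, mdist (psi x) (psi y) = mdist x y) ->
  (forall t, psi (c (t + b)) = c t) ->
  nearest c x s -> nearest c (psi x) (s - b).
Proof. by move=> h1 h2 h t; rewrite -(h2 (s - b)) -(h2 t) !h1 subrK; exact: h. Qed.

Lemma dist_recenter c x b (psi : X -> X) t :
  (forall x y, mdist (psi x) (psi y) = mdist x y) ->
  (forall t, psi (c (t + b)) = c t) ->
  mdist (psi x) (c t) = mdist x (c (t + b)).
Proof. by move=> h1 h2; rewrite -h2 h1. Qed.

End Line.

Section RankOneLine.
Variables (R : realType) (X : metricType R).
Hypothesis CN : CN_inequality X.
Hypothesis geo : geodesic_space X.
Hypothesis pX : proper_space X.

Section Steep.
Variables (c : R -> X) (l : R).
Hypothesis lc : geodesic_line c.
Hypothesis rc : recentering c l.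
Hypothesis nb : ~ bounds_flat_half_plane c.

Let f (x : X) (t : R) := mdist x (c t).

Let cf x : convexR (f x).
Proof. exact: convexR_dist_line. Qed.

Lemma slope_ge0 x s : nearest c x s -> s <= 0 -> 0 <= f x 1 - f x 0.
Proof.
move=> ns; rewrite le_eqVlt => /predU1P[s0|s0].
  by rewrite subr_ge0 -{1}s0; exact: ns.
have := convexR_slope (cf x) s0 (lexx 0) ltr01.
have := ns 0; rewrite -/(f x s) -/(f x 0) => ? h; nra.
Qed.

(** The slopes of [f x] increase. If the slope between [0] and [1] can be at
    most [k0 + d] for points whose nearest point is arbitrarily far to the left,
    while it cannot be at most [k0 - d], then for some [x] all slopes on a long
    interval to the left of [0] are within [d] of [k0]; this interval is moved to
    the middle of the line. *)
Lemma almost_affine (k0 d : R) (m : nat) : 0 < d ->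
  (forall n : R, exists x s, [/\ nearest c x s, s <= - n & f x 1 - f x 0 <= k0 + d]) ->
  ~ (forall n : R, exists x s, [/\ nearest c x s, s <= - n & f x 1 - f x 0 <= k0 - d]) ->
  exists y, forall t, `|t| <= m%:R -> `|k0 * t - (f y t - f y 0)| <= d * `|t|.
Proof.
move=> d0 hu /existsNP[n0 hn0].
have [x [s [ns sn sl]]] := hu (n0 + 2 * m%:R + 2 * l + 1).
have [b [psi [/andP[b1 b2] p1 p2]]] := rc (- m%:R - l).
pose y := psi x; exists y.
have fy t : f y t = f x (t + b) by exact: dist_recenter.
have [b' [psi' [/andP[b1' b2'] p1' p2']]] := rc (- m%:R - 1 - l).
have fy' t : f (psi' y) t = f y (t + b') by exact: dist_recenter.
have lowslope : k0 - d < f y (1 + b') - f y b'.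
  rewrite ltNge; apply/negP => h; apply: hn0; exists (psi' y), (s - b - b').
  split; [|lra|by rewrite !fy' add0r].
  by apply: nearest_recenter => //; exact: nearest_recenter.
have up p q : p < q -> q <= m%:R -> f y q - f y p <= (k0 + d) * (q - p).
  move=> pq qm.
  have h0 : p + b < q + b by lra. have h1 : q + b <= 0 by lra.
  have := convexR_slope (cf x) h0 h1 ltr01; rewrite !fy subr0 mulr1.
  have -> : q + b - (p + b) = q - p by ring.
  move=> /le_trans; apply; apply: ler_wpM2r sl; lra.
have lo p q : p < q -> - m%:R <= p -> (k0 - d) * (q - p) <= f y q - f y p.
  move=> pq qm.
  have h0 : b' < 1 + b' by lra. have h1 : 1 + b' <= p by lra.
  have := convexR_slope (cf y) h0 h1 pq.
  rewrite addrK mulr1; apply: le_trans.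
  by apply: ler_wpM2r; [lra|exact: ltW].
move=> t; rewrite ler_norml => /andP[t1 t2].
have [t0|t0|->] := ltgtP t 0; last by rewrite mulr0 subrr subr0 normr0 mulr0.
  have := up _ _ t0 (ler0n _ _); have := lo _ _ t0 t1.
  rewrite (ltr0_norm t0) ler_norml => h1 h2; apply/andP; split; nra.
have := up _ _ t0 t2; have := lo _ _ t0 _; rewrite oppr_le0 ler0n => /(_ isT).
rewrite (gtr0_norm t0) ler_norml => h1 h2; apply/andP; split; nra.
Qed.

(** Let [k0] be the infimum of the slopes that occur at [0] for points whose
    nearest point is arbitrarily far to the left. If [k0 < 1], then
    [almost_affine] with [d := 1 / (m + 1)] gives points with distance functions
    that converge to an affine function of slope [k0]. *)
Lemma steep_at_0 (k : R) : k < 1 -> exists n : R, forall x s,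
  nearest c x s -> s <= - n -> k < f x 1 - f x 0.
Proof.
move=> k1; apply: contrapT => hc.
pose S := [set k : R | forall n : R, exists x s,
  [/\ nearest c x s, s <= - n & f x 1 - f x 0 <= k]].
have Sk : S k.
  move=> n; apply: contrapT => hn; apply: hc; exists n => x s ns sn.
  by rewrite ltNge; apply/negP => h; apply: hn; exists x, s.
have lbS : lbound S 0.
  move=> k' /(_ 0) [x [s [ns sn]]]; apply: le_trans.
  by apply: slope_ge0 ns _; lra.
have hS : has_inf S by split; [exists k|exists 0].
pose k0 := inf S.
have k00 : 0 <= k0 by apply: lb_le_inf => //; exists k.
have k01 : k0 < 1 by apply: le_lt_trans k1; apply: ge_inf => //; exists 0.
have H (m : nat) : exists y, forall t, `|t| <= m%:R ->
    `|k0 * t - (f y t - f y 0)| <= m.+1%:R^-1 * `|t|.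
  have d0 : 0 < m.+1%:R^-1 :> R by rewrite invr_gt0.
  apply: almost_affine => //.
    have [k' Sk' kk'] := inf_adherent d0 hS.
    move=> n; have [x [s [h1 h2 h3]]] := Sk' n; exists x, s; split=> //.
    by apply: (le_trans h3); exact: ltW.
  move=> h; have : k0 <= k0 - m.+1%:R^-1 by apply: ge_inf => //; exists 0.
  by rewrite lerBrDr gerDl leNgt d0.
have [y hy] := choice H.
have [U [UU Uoo]] := ultrafilter_at_infinity.
apply: nb; apply: (@affine_limit_half_plane _ _ CN geo pX U c y k0 UU lc).
  by rewrite k01 andbT; apply: lt_le_trans k00; rewrite ltrN10.
move=> t; apply/cvgrPdist_le => e e0.
have [n1 hn1] := nat_above `|t|; have [n2 hn2] := nat_above (`|t| / e).
apply: filterS (Uoo (maxn n1 n2)) => i /=; rewrite geq_max => /andP[i1 i2].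
have ti : `|t| <= i%:R by apply: (le_trans hn1); rewrite ler_nat.
apply: (le_trans (hy i t ti)).
rewrite mulrC ler_pdivrMr// mulrC -ler_pdivrMr//.
by apply: (le_trans hn2); rewrite ler_nat (leq_trans i2).
Qed.

Lemma eventually_steep (k : R) : k < 1 -> exists n : R, forall x s t,
  nearest c x s -> s + n <= t -> k < f x (t + 1) - f x t.
Proof.
move=> /steep_at_0[n hn]; exists (n + l + 1) => x s t ns st.
have [b [psi [/andP[b1 b2] p1 p2]]] := rc (t - l - 1).
have h := hn _ _ (nearest_recenter p1 p2 ns).
have {}h : k < f x (1 + b) - f x b.
  have {}h := h _; move: h; rewrite /f !(dist_recenter x _ p1 p2) add0r.
  by apply; lra.
apply: (lt_le_trans h).
have i1 : b < 1 + b by lra. have i2 : 1 + b <= t by lra.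
have i3 : t < t + 1 by lra.
have := convexR_slope (cf x) i1 i2 i3.
by rewrite addrK [t + 1]addrC addrK !mulr1.
Qed.

(** When the slope of the distance to [x] is at least [k] on the whole of
    [[- tau, 0]], the CN inequality in the triangle [c (- tau)], [c 0], [x] bounds
    the squared distance by [2 (1 - k) tau ^+ 2]. *)
Lemma backward_close (tau e : R) : 0 <= tau -> 0 < e -> exists n : R,
  forall x s z, nearest c x s -> s <= - n -> mdist (c 0) z = tau ->
  mdist (c 0) z + mdist z x = mdist (c 0) x -> mdist (c (- tau)) z <= e.
Proof.
rewrite le_eqVlt => /predU1P[<-|tau0] e0.
  by exists 0 => x s z _ _ /mdist_positivity <- _; rewrite oppr0 mdistxx ltW.
pose q := 2 * tau ^+ 2 + e ^+ 2 + 1.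
have q0 : 0 < q by rewrite /q; nra.
(* This is close enough to 1 for 2 (1 - k) tau^2 <= e^2. *)
pose k := 1 - e ^+ 2 / q.
have kq : (1 - k) * q = e ^+ 2 by rewrite /k opprB addrC subrK divfK// gt_eqF.
have k1 : k < 1 by rewrite /k gtrBl divr_gt0// exprn_gt0.
have k0 : 0 <= k by rewrite /k subr_ge0 ler_pdivrMr// mul1r /q; nra.
have [n hn] := eventually_steep k1; exists (n + tau + 1) => x s z ns sn zt zx.
have sl : f x (- tau) <= f x 0 - k * tau.
  have h : k < f x (- tau - 1 + 1) - f x (- tau - 1) by apply: hn ns _; lra.
  rewrite subrK in h.
  have i1 : - tau - 1 < - tau by lra. have i2 : - tau < 0 by lra.
  have := convexR_slope (cf x) i1 (lexx _) i2.
  have -> : - tau - (- tau - 1) = 1 by ring.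
  by rewrite sub0r opprK mulr1 => h2; have := ler_wpM2r (ltW tau0) (ltW h); lra.
pose D := mdist (c 0) x; have DE : f x 0 = D by rewrite /f metric_sym.
have z0 := mdist_ge0 z x.
have D0 : 0 < D by rewrite /D -zx zt; lra.
have tD : tau <= D by rewrite /D -zx zt; lra.
pose u := tau / D; have uD : u * D = tau by rewrite /u divfK// gt_eqF.
have u0 : 0 <= u by rewrite /u divr_ge0 ?ltW.
have u1 : u <= 1 by rewrite /u ler_pdivrMr// mul1r.
have du : divides u (c 0) x z.
  rewrite /divides -/D uD mulrBl mul1r uD; split=> //.
  by rewrite /D -zx zt addrC addKr.
have u01 : 0 <= u <= 1 by rewrite u0.
have := CN (c (- tau)) u01 du.
rewrite lc subr0 normrN (gtr0_norm tau0) (metric_sym (c (- tau)) x) -/(f x (- tau)) -/D.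
have f0 : 0 <= f x (- tau) by exact: mdist_ge0.
rewrite DE in sl => h.
have {}h : mdist (c (- tau)) z ^+ 2 <= 2 * (1 - k) * tau ^+ 2.
  apply: (le_trans h).
  have h2 : f x (- tau) ^+ 2 <= (D - k * tau) ^+ 2.
    by rewrite ler_pXn2r// nnegrE// (le_trans f0).
  have h3 := ler_wpM2l u0 h2.
  have -> : (1 - u) * tau ^+ 2 + u * f x (- tau) ^+ 2 - u * (1 - u) * D ^+ 2
     = u * f x (- tau) ^+ 2 + ((1 - u) * tau ^+ 2 - u * (1 - u) * D ^+ 2) by ring.
  apply: (@le_trans _ _ (u * (D - k * tau) ^+ 2 +
     ((1 - u) * tau ^+ 2 - u * (1 - u) * D ^+ 2))); first by rewrite lerD2r.
  have -> : u * (D - k * tau) ^+ 2 + ((1 - u) * tau ^+ 2 - u * (1 - u) * D ^+ 2) =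
    (u * D) ^+ 2 - 2 * k * (u * D) * tau + tau ^+ 2 - u * tau ^+ 2 * (1 - k ^+ 2)
    by ring.
  rewrite uD.
  have : 0 <= u * tau ^+ 2 * (1 - k ^+ 2).
    apply: mulr_ge0; first by rewrite mulr_ge0 ?sqr_ge0.
    by rewrite subr_ge0 expr_le1// ltW.
  lra.
rewrite -(ler_pXn2r (_ : (0 < 2)%N)) ?nnegrE ?mdist_ge0 ?(ltW e0)//.
apply: (le_trans h); rewrite -kq /q.
have : 0 <= (1 - k) * (e ^+ 2 + 1).
  by rewrite mulr_ge0 ?subr_ge0 ?(ltW k1)// addr_ge0 ?sqr_ge0.
lra.
Qed.

(** Geodesics that end at [x] and start from [c 0] and from [p] stay within [r] by
    convexity; the second [r] makes up for the different lengths of the two, and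
    [1] is the error in [backward_close]. *)
Lemma fellow_travel (tau r : R) : 0 <= tau -> exists n : R,
  forall x s p w, nearest c x s -> s <= - n -> mdist (c 0) p <= r ->
  mdist p w = tau -> mdist p w + mdist w x = mdist p x ->
  mdist (c (- tau)) w <= 2 * r + 1.
Proof.
move=> t0; have [n hn] := backward_close t0 ltr01.
exists (`|n| + 2 * (tau + 1)) => x s p w ns sn pr pw wx.
have n1 := ler_norm n.
have r0 : 0 <= r by apply: le_trans pr; exact: mdist_ge0.
have tx : tau + 1 <= mdist (c 0) x.
  have := metric_triangle (c 0) x (c s); rewrite lc sub0r normrN.
  have := ns 0; rewrite (metric_sym x (c 0)) => h1 h2.
  have := ler_norm (- s); rewrite normrN; have := normr_ge0 n; lra.
have [|z [z1 z2]] := @point_at_distance _ _ geo (c 0) x tau; first by rewrite t0 /=; lra.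
have zb : mdist (c 0) z + mdist z x = mdist (c 0) x by rewrite z1 z2; ring.
have e1 : mdist (c (- tau)) z <= 1 by apply: (hn x s) => //; have := normr_ge0 n; lra.
have [u u01 du] := between_divides wx.
have [z' dz'] := divides_exists geo (c 0) x u01.
have e2 : mdist z' w <= r.
  have := convex_dist CN geo u01 dz' du; rewrite mdistxx mulr0 addr0.
  move=> /le_trans; apply; apply: le_trans pr; apply: ler_piMl => //.
    exact: mdist_ge0.
  by case/andP: u01; lra.
have zb' : mdist (c 0) z' + mdist z' x = mdist (c 0) x.
  by case: dz' => -> ->; ring.
have e3 : mdist z z' <= r.
  rewrite (between_same CN geo zb zb') z1; case: dz' => -> _.
  case: du => wu _; rewrite -pw wu -mulrBr normrM.
  have h : `|mdist p x - mdist (c 0) x| <= mdist (c 0) p.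
    by rewrite (metric_sym p x) (metric_sym (c 0) x) (metric_sym (c 0) p);
      exact: mdist_lip.
  have /andP[u0 u1] := u01; rewrite (ger0_norm u0).
  apply: le_trans (le_trans h pr); apply: ler_piMl => //; exact: normr_ge0.
have := metric_triangle (c (- tau)) z w; have := metric_triangle z z' w; lra.
Qed.

End Steep.
End RankOneLine.

(** * Parallel lines *)

Section Contraction.
Variables (R : realType) (X : metricType R).
Hypothesis CN : CN_inequality X.
Hypothesis geo : geodesic_space X.
Hypothesis pX : proper_space X.

Section Parallel.
Variables (c s : R -> X) (K : R).
Hypothesis lc : geodesic_line c.
Hypothesis ls : geodesic_line s.
Hypothesis par : forall t, mdist (c t) (s t) <= K.

Lemma parallel_invariant t v r :
  mdist (c (t + r)) (s (v + r)) = mdist (c t) (s v).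
Proof.
have cv := convexR_dist_lines CN geo (v - t) lc ls.
have bd a : 0 <= mdist (c a) (s (v - t + a)) <= K + `|v - t|.
  rewrite mdist_ge0/=; apply: (le_trans (metric_triangle _ (s a) _)).
  apply: lerD (par a) _; rewrite ls distrC addrK.
  exact: lexx.
have := convexR_bounded_const cv bd (t + r) t.
rewrite subrK => <-; congr (mdist _ (s _)); ring.
Qed.

(** The squared distance from [s w] to the points of [c], minus [t ^+ 2], is
    midpoint convex by the CN inequality and midpoint concave by the parallelogram
    inequality, because only the difference of the parameters matters on parallel
    lines. It is thus the sum of a constant and an additive function [G], and since
    [t0] is nearest [G] is bounded below by [- t ^+ 2], hence [G = 0]. *)
Lemma parallel_dist w t0 t : nearest c (s w) t0 ->
  mdist (s w) (c (t0 + t)) ^+ 2 = mdist (s w) (c t0) ^+ 2 + t ^+ 2.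
Proof.
move=> nw; pose e t := mdist (s w) (c (t0 + t)) ^+ 2.
have e_up a u : e (a + u) + e (a - u) <= 2 * e a + 2 * u ^+ 2.
  have := parallelogram CN geo (c (t0 + a)) (c (t0 + a + u)) (s (w + u)) (s w).
  have -> : mdist (c (t0 + a)) (s (w + u)) ^+ 2 = e (a - u).
    rewrite -(parallel_invariant (t0 + a) (w + u) (- u)) addrK metric_sym.
    by rewrite /e addrA.
  have -> : mdist (c (t0 + a + u)) (s w) ^+ 2 = e (a + u).
    by rewrite metric_sym /e addrA.
  have -> : mdist (c (t0 + a + u)) (s (w + u)) ^+ 2 = e a.
    by rewrite parallel_invariant metric_sym.
  rewrite -/(e a) lc ls.
  rewrite !real_normK ?num_real//.
  have -> : t0 + a - (t0 + a + u) = - u by ring.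
  have -> : w + u - w = u by ring.
  rewrite sqrrN; lra.
have e_lo a u : 2 * e a + 2 * u ^+ 2 <= e (a + u) + e (a - u).
  have := midpoint_CN CN (s w) (t0 + a) u lc.
  rewrite -!addrA -/(e a) -/(e (a + u)) -/(e (a - u)); lra.
pose G t := e t - e 0 - t ^+ 2.
have GG a u : G (a + u) + G (a - u) = 2 * G a.
  have := e_up a u; have := e_lo a u; rewrite /G => h1 h2.
  have -> : e (a + u) - e 0 - (a + u) ^+ 2 + (e (a - u) - e 0 - (a - u) ^+ 2) =
    (e (a + u) + e (a - u)) - 2 * e 0 - 2 * a ^+ 2 - 2 * u ^+ 2 by ring.
  lra.
have G0 : G 0 = 0 by rewrite /G; ring.
have Gm a : - a ^+ 2 <= G a.
  rewrite /G -[leLHS]add0r lerD2r subr_ge0 ler_pXn2r ?nnegrE ?mdist_ge0//.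
  by rewrite addr0; exact: nw.
(* G a is 2^n times G (a / 2^n), and the lower bound is quadratic. *)
have Gn n a : - a ^+ 2 <= 2 ^+ n * G a.
  elim: n a => [|n IH] a; first by rewrite expr0 mul1r.
  have := GG (a / 2) (a / 2); rewrite -splitr subrr G0 addr0 => ->.
  have := IH (a / 2); have -> : (a / 2) ^+ 2 = a ^+ 2 / 4 by field.
  rewrite (exprS 2 n); have := sqr_ge0 a.
  move: (2 ^+ n) (G _) (a ^+ 2) => A B C; lra.
have Gp a : 0 <= G a.
  rewrite leNgt; apply/negP => h.
  have [n hn] := nat_above ((a ^+ 2 + 1) / - G a).
  have := Gn n a; rewrite leNgt => /negP; apply.
  have n2 : (n%:R : R) <= 2 ^+ n by rewrite -natrX ler_nat ltnW// ltn_expl.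
  have hh : 0 < - G a by rewrite oppr_gt0.
  have := le_trans hn n2; rewrite ler_pdivrMr//.
  move: (2 ^+ n) (G _) (a ^+ 2) => A B C; lra.
have Gz : G t = 0.
  have := GG 0 t; rewrite G0 add0r sub0r mulr0 => h.
  have := Gp t; have := Gp (- t); lra.
move: Gz; rewrite /G /e addr0; move: (_ ^+ 2) (_ ^+ 2) => A B; lra.
Qed.

End Parallel.

Section Contracting.
Variables (c : R -> X) (l : R).
Hypothesis lc : geodesic_line c.
Hypothesis rc : recentering c l.
Hypothesis nb : ~ bounds_flat_half_plane c.

(** For a point of a parallel line at distance [r] of [c], the distance to [c t]
    is the square root of [r ^+ 2 + t ^+ 2] after recentering, which is almost
    constant in [t] when [r] is large. Lines at unbounded distance would thus give
    a half plane, with slope [0]. *)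
Lemma parallel_bounded : exists2 r : R, 0 <= r & forall s K, geodesic_line s ->
  (forall t, mdist (c t) (s t) <= K) ->
  forall w t0, nearest c (s w) t0 -> mdist (s w) (c t0) < r.
Proof.
apply: contrapT => hc.
have H (n : nat) : exists y, exists r a, [/\ n.+1%:R <= r, 0 <= a <= l &
    forall t, mdist y (c t) ^+ 2 = r ^+ 2 + (t + a) ^+ 2].
  apply: contrapT => hn; apply: hc; exists n.+1%:R => // s K ls par w t0 nw.
  rewrite ltNge; apply/negP => h; apply: hn.
  have [b [psi [/andP[b1 b2] p1 p2]]] := rc t0.
  exists (psi (s w)), (mdist (s w) (c t0)), (b - t0); split=> //.
    by apply/andP; split; lra.
  move=> t; rewrite (dist_recenter _ _ p1 p2) -(parallel_dist lc ls par)//.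
  by congr (mdist _ (c _) ^+ 2); ring.
have [y hy] := choice H.
have [U [UU Uoo]] := ultrafilter_at_infinity.
apply: nb; apply: (@affine_limit_half_plane _ _ CN geo pX U c y 0 UU lc).
  by rewrite ltrN10 ltr01.
move=> t; rewrite mul0r; apply/cvgrPdist_le => e e0.
have [n0 hn] := nat_above ((t ^+ 2 + 2 * l * `|t|) / e).
apply: filterS (Uoo n0) => i /= ni; rewrite sub0r normrN.
have [r [a [ri /andP[a0 al] hr]]] := hy i.
have r0 : 0 < r by apply: lt_le_trans ri.
have ge_r u : r <= mdist (y i) (c u).
  rewrite -(ler_pXn2r (_ : (0 < 2)%N)) ?nnegrE ?mdist_ge0 ?(ltW r0)//.
  by rewrite hr lerDl sqr_ge0.
have q1 : `|mdist (y i) (c t) - mdist (y i) (c 0)| * r <= t ^+ 2 + 2 * l * `|t|.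
  apply: (@le_trans _ _ (`|mdist (y i) (c t) - mdist (y i) (c 0)| *
      `|mdist (y i) (c t) + mdist (y i) (c 0)|)).
    apply: ler_wpM2l; first exact: normr_ge0.
    apply: le_trans (ler_norm _); have := ge_r t; have := mdist_ge0 (y i) (c 0); lra.
  rewrite -normrM -subr_sqr !hr.
  have -> : r ^+ 2 + (t + a) ^+ 2 - (r ^+ 2 + (0 + a) ^+ 2) = t ^+ 2 + 2 * a * t by ring.
  apply: (le_trans (ler_normD _ _)).
  rewrite [`|t ^+ 2|]ger0_norm ?sqr_ge0// lerD2l.
  rewrite normrM ger0_norm ?mulr_ge0//.
  by apply: ler_wpM2r; [exact: normr_ge0|lra].
have q2 : n0%:R <= r.
  by apply: le_trans ri; rewrite ler_nat (leq_trans ni).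
rewrite -(ler_pM2r r0); apply: (le_trans q1).
by rewrite -ler_pdivrMl// mulrC (le_trans hn).
Qed.

(** The endpoints are moved from [c] to [x] and [y] along geodesics, by steps of
    size at most [1]. The geodesic between them is [c] at first and in the end it
    stays away from [c 0]; the first step at which it stays away is taken. *)
Lemma last_close_geodesic (r0 t1 t2 : R) x y : 0 <= r0 -> t1 <= 0 -> 0 <= t2 ->
  nearest c x t1 -> nearest c y t2 ->
  (forall z, mdist x z + mdist z y = mdist x y -> r0 < mdist (c 0) z) ->
  exists x' y', [/\ nearest c x' t1, nearest c y' t2,
    forall z, mdist x' z + mdist z y' = mdist x' y' -> r0 < mdist (c 0) z &
    exists z, mdist x' z + mdist z y' = mdist x' y' /\ mdist (c 0) z <= r0 + 1].
Proof.
move=> r00 t10 t20 nx ny far.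
pose Q (v : R) := exists z x' y', [/\ divides v (c t1) x x', divides v (c t2) y y',
  mdist x' z + mdist z y' = mdist x' y' & mdist (c 0) z <= r0].
have Q0 : Q 0.
  exists (c 0), (c t1), (c t2); rewrite /divides !mdistxx !mul0r !subr0 !mul1r.
  split=> //; rewrite !lc subr0 sub0r normrN.
  by rewrite ler0_norm// ger0_norm// ler0_norm; lra.
have Q1 : ~ Q 1.
  move=> [z [x' [y' [[_ h1] [_ h2] h3]]]]; rewrite subrr !mul0r in h1 h2.
  rewrite (mdist_positivity _ _ h1) (mdist_positivity _ _ h2) in h3.
  by rewrite leNgt far.
pose M := Num.max (mdist (c t1) x) (mdist (c t2) y).
have [k hk] := nat_above M.
have k0 : 0 < k.+1%:R :> R by [].
have [j [jk Qj Qj1]] : exists j : nat, [/\ (j < k.+1)%N, Q (j%:R / k.+1%:R) &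
    ~ Q (j.+1%:R / k.+1%:R)].
  apply: contrapT => hn; apply: Q1.
  have : forall j : nat, (j <= k.+1)%N -> Q (j%:R / k.+1%:R).
    elim=> [|j IH] jk; first by rewrite mul0r.
    by apply: contrapT => h; apply: hn; exists j; split=> //; apply: IH; exact: ltnW.
  by move=> /(_ _ (leqnn _)); rewrite divff// gt_eqF.
pose v := j%:R / k.+1%:R : R; pose w := j.+1%:R / k.+1%:R : R.
have w01 : 0 <= w <= 1.
  by rewrite /w divr_ge0 ?ler0n//= ler_pdivrMr// mul1r ler_nat.
have wv : w - v = k.+1%:R^-1 by rewrite /w /v -mulrBl -natrB// subSnn mul1r.
have [x2 dx2] := divides_exists geo (c t1) x w01.
have [y2 dy2] := divides_exists geo (c t2) y w01.
have near_div a t u x' : 0 <= u <= 1 -> nearest c a t -> divides u (c t) a x' ->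
    nearest c x' t.
  move=> /andP[u0 u1] na [d1 d2] t'; rewrite (metric_sym x') d1.
  have := na t'; have := metric_triangle a x' (c t').
  by rewrite (metric_sym a x') d2 (metric_sym a (c t)); lra.
have between_div a t u x' : divides u (c t) a x' ->
    mdist (c t) x' + mdist x' a = mdist (c t) a by case=> -> ->; ring.
have close a t x' x'' : mdist (c t) a <= M -> divides v (c t) a x' ->
    divides w (c t) a x'' -> mdist x' x'' <= 1.
  move=> aM d1 d2.
  rewrite (between_same CN geo (between_div _ _ _ _ d1) (between_div _ _ _ _ d2)).
  case: d1 => -> _; case: d2 => -> _; rewrite -mulrBl normrM distrC wv.
  rewrite !ger0_norm ?mdist_ge0 ?invr_ge0// mulrC ler_pdivrMr// mul1r.
  by apply: (le_trans aM); apply: (le_trans hk); rewrite ler_nat.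
exists x2, y2; split.
- exact: (near_div _ _ _ _ w01 nx dx2).
- exact: (near_div _ _ _ _ w01 ny dy2).
- move=> z hz; rewrite ltNge; apply/negP => h; apply: Qj1.
  by exists z, x2, y2.
have [z [x1 [y1 [dx1 dy1 hz zr]]]] := Qj.
have [u u01 du] := between_divides hz.
have [z2 dz2] := divides_exists geo x2 y2 u01.
exists z2; split; first by case: dz2 => -> ->; ring.
have h1 : mdist x1 x2 <= 1 by apply: (close _ _ _ _ _ dx1 dx2); rewrite /M le_max lexx.
have h2 : mdist y1 y2 <= 1.
  by apply: (close _ _ _ _ _ dy1 dy2); rewrite /M le_max lexx orbT.
have := convex_dist CN geo u01 du dz2.
have := metric_triangle (c 0) z z2.
have /andP[u0 u1] := u01 => tr cd.
have : (1 - u) * mdist x1 x2 + u * mdist y1 y2 <= 1.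
  have a1 : (1 - u) * mdist x1 x2 <= (1 - u) * 1 by apply: ler_wpM2l => //; lra.
  have a2 : u * mdist y1 y2 <= u * 1 by apply: ler_wpM2l.
  lra.
lra.
Qed.

End Contracting.
End Contraction.

(** * Contraction of axes *)

Section Passing.
Variables (R : realType) (X : metricType R).
Hypothesis CN : CN_inequality X.
Hypothesis geo : geodesic_space X.
Hypothesis pX : proper_space X.
Variables (c : R -> X) (l : R).
Hypothesis lc : geodesic_line c.
Hypothesis rc : recentering c l.
Hypothesis nb : ~ bounds_flat_half_plane c.

Lemma nearest_far x s : nearest c x s -> `|s| <= 2 * mdist (c 0) x.
Proof.
move=> ns; have := metric_triangle (c s) x (c 0).
rewrite lc subr0 (metric_sym _ x) (metric_sym (c 0)).
by have := ns 0; lra.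
Qed.

Lemma fellow_travel_forward (tau r : R) : 0 <= tau -> exists n : R,
  forall x s p w, nearest c x s -> n <= s -> mdist (c 0) p <= r ->
  mdist p w = tau -> mdist p w + mdist w x = mdist p x ->
  mdist (c tau) w <= 2 * r + 1.
Proof.
move=> t0; have nb' : ~ bounds_flat_half_plane (reversed c).
  by move=> h; exact/nb/bounds_flat_half_plane_rev.
have [n hn] := fellow_travel CN geo pX (geodesic_line_rev lc)
  (recentering_rev rc) nb' r t0.
exists n => x s p w ns sn pr pw wx.
have := hn x (- s) p w (nearest_rev ns).
by rewrite /reversed oppr0 opprK lerN2; apply.
Qed.

(** What is kept of a geodesic that avoids [c 0], once its endpoints have been
    moved towards [c]: the ultralimit of such arcs is a line, as [A] and [B] go to
    infinity with [n]. *)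
Definition long_arc (r0 : R) (n : nat) (g : R -> X) := exists A B x y t1 t2,
  [/\ nearest c x t1, nearest c y t2, t1 <= - n%:R & n%:R <= t2] /\
  [/\ 0 <= A, 0 <= B, g (- A) = x, g B = y &
  [/\ forall a b, - A <= a <= B -> - A <= b <= B -> mdist (g a) (g b) = `|a - b|,
      forall a, - A <= a <= B -> r0 <= mdist (c 0) (g a) &
      mdist (c 0) (g 0) <= r0 + 1]].

Lemma long_arc_exists (r0 : R) (n : nat) x y t1 t2 : 0 <= r0 ->
  nearest c x t1 -> nearest c y t2 -> t1 <= - n%:R -> n%:R <= t2 ->
  (forall z, mdist x z + mdist z y = mdist x y -> r0 < mdist (c 0) z) ->
  exists g, long_arc r0 n g.
Proof.
move=> r00 nx ny t1n t2n far.
have n0 : 0 <= n%:R :> R by [].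
have t10 : t1 <= 0 by lra. have t20 : 0 <= t2 by lra.
have [x' [y' [nx' ny' far' [z [hz zr]]]]] :=
  last_close_geodesic CN geo lc r00 t10 t20 nx ny far.
have [h [D gD]] := geo x' y'.
have DE := geodesic_segment_length gD; have [D0 hx hy hd] := gD.
have z1 := mdist_ge0 x' z; have z2 := mdist_ge0 z y'.
pose A := mdist x' z.
have AD : 0 <= A <= D by rewrite DE -hz /A; lra.
have bet a : 0 <= a <= D -> mdist x' (h a) + mdist (h a) y' = mdist x' y'.
  move=> /andP[a0 aD]; rewrite -{1}hx -{1}hy !hd ?lexx ?D0 ?a0//.
  rewrite sub0r normrN ger0_norm// distrC ger0_norm ?subr_ge0// -DE; ring.
have xA : mdist x' (h A) = A.
  rewrite -hx hd ?lexx ?D0// sub0r normrN ger0_norm//; by case/andP: AD.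
have zE : h A = z.
  apply: mdist_positivity.
  by rewrite (between_same CN geo (bet _ AD) hz) xA subrr normr0.
exists (fun t => h (A + t)), A, (D - A), x', y', t1, t2; split=> //.
have /andP[A0 A1] := AD.
split=> //; [lra|by rewrite subrr|by rewrite addrC subrK|].
have sh a : - A <= a <= D - A -> 0 <= A + a <= D by move=> /andP[? ?]; lra.
split=> [a b ha hb|a ha|].
- by rewrite hd ?sh//; congr (`|_|); ring.
- by apply: ltW; apply: far'; apply: bet; exact: sh.
- by rewrite addr0 zE.
Qed.

Lemma long_arc_spread (r0 : R) tau : 0 <= r0 -> exists N : nat, forall n g, (N <= n)%N ->
  long_arc r0 n g ->
  [/\ mdist (c tau) (g tau) <= 2 * (r0 + 1) + 1, r0 <= mdist (c 0) (g tau),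
      mdist (c 0) (g 0) <= r0 + 1 &
      forall a b, `|a| <= `|tau| -> `|b| <= `|tau| -> mdist (g a) (g b) = `|a - b|].
Proof.
move=> r00.
have [n1 h1] := fellow_travel CN geo pX lc rc nb (r0 + 1) (normr_ge0 tau).
have [n2 h2] := fellow_travel_forward (r0 + 1) (normr_ge0 tau).
have [N hN] := nat_above (`|n1| + `|n2| + 2 * `|tau| + 2 * (r0 + 1)).
exists N => n g Nn [A [B [x [y [t1 [t2 [[nx ny t1n t2n] [A0 B0 gA gB [iso far near]]]]]]]]].
have hn : N%:R <= n%:R :> R by rewrite ler_nat.
have fx := nearest_far nx; have fy := nearest_far ny.
have a1 := ler_norm (- t1); have a2 := ler_norm t2; rewrite normrN in a1.
have a3 := normr_ge0 n1; have a4 := normr_ge0 n2.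
have a5 := ler_norm n1; have a6 := ler_norm n2.
have a7 := ler_norm tau; have a8 := ler_norm (- tau); rewrite normrN in a8.
have a9 := normr_ge0 tau.
have iA : - A <= - A <= B by lra. have iB : - A <= B <= B by lra.
have i0 : - A <= 0 <= B by lra.
have xA : mdist (g 0) x = A by rewrite -gA iso// sub0r opprK ger0_norm.
have yB : mdist (g 0) y = B by rewrite -gB iso// sub0r normrN ger0_norm.
have tx := metric_triangle (c 0) (g 0) x; have ty := metric_triangle (c 0) (g 0) y.
rewrite xA in tx; rewrite yB in ty.
have tA : `|tau| <= A by lra. have tB : `|tau| <= B by lra.
have s1 : t1 <= - n1 by lra. have s2 : n2 <= t2 by lra.
clear fx fy tx ty a1 a2 a3 a4 a5 a6 hN hn t1n t2n.
have it : - A <= tau <= B by apply/andP; split; lra.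
split=> //; [|exact: far|]; last first.
  have inside a : `|a| <= `|tau| -> - A <= a <= B.
    by move=> /ler_normlP[? ?]; apply/andP; split; lra.
  by move=> a b ha hb; apply: iso; exact: inside.
have [t0|t0] := leP tau 0.
  have -> : c tau = c (- `|tau|) by rewrite ler0_norm// opprK.
  apply: (h1 x t1 (g 0)) => //; first by rewrite iso// sub0r normrN.
  rewrite -gA !iso// !sub0r !normrN opprK (ler0_norm t0) (ger0_norm A0).
  by rewrite ger0_norm; lra.
have -> : c tau = c `|tau| by rewrite gtr0_norm.
apply: (h2 y t2 (g 0)) => //; first by rewrite iso// sub0r normrN.
rewrite -gB !iso// !sub0r !normrN (gtr0_norm t0) (ger0_norm B0).
by rewrite ler0_norm; lra.
Qed.

(** Otherwise there are long arcs, and [fellow_travel] on both sides keeps them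
    within a bounded distance of [c]. Their ultralimit is a line parallel to [c],
    whose distance to [c 0] is at least [r0]. With the [r0] of [parallel_bounded]
    this is impossible. *)
Lemma passes_near_0 : exists N r : R, forall x y t1 t2,
  nearest c x t1 -> nearest c y t2 -> t1 <= - N -> N <= t2 ->
  exists z, mdist x z + mdist z y = mdist x y /\ mdist (c 0) z <= r.
Proof.
have [r0 r00 hr] := parallel_bounded CN geo pX lc rc nb.
apply: contrapT => hc.
have H (n : nat) : exists g, long_arc r0 n g.
  apply: contrapT => hn; apply: hc; exists n%:R, r0 => x y t1 t2 nx ny h1 h2.
  apply: contrapT => hz; apply: hn.
  apply: (long_arc_exists r00 nx ny h1 h2) => z zb.
  by rewrite ltNge; apply/negP => h; apply: hz; exists z.
have [g hg] := choice H.
have [U [UU Uoo]] := ultrafilter_at_infinity.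
have spread tau : \forall n \near U,
  [/\ mdist (c tau) (g n tau) <= 2 * (r0 + 1) + 1, r0 <= mdist (c 0) (g n tau),
      mdist (c 0) (g n 0) <= r0 + 1 &
      forall a b, `|a| <= `|tau| -> `|b| <= `|tau| ->
      mdist (g n a) (g n b) = `|a - b|].
  have [N hN] := long_arc_spread tau r00.
  by apply: filterS (Uoo N) => n /= Nn; exact: hN (hg n).
have L tau : exists z, ulimit U (fun n => g n tau) z.
  apply: (@ulimit_exists _ _ U UU _ (c tau) (2 * (r0 + 1) + 1)) => //.
  by apply: filterS (spread tau) => n [].
have [s hs] := choice L.
have ls : geodesic_line s.
  move=> a b; have cd := @ulimit_dist _ _ U UU _ _ _ _ (hs a) (hs b).
  have e : \forall n \near U, mdist (g n a) (g n b) = `|a - b|.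
    apply: filterS (spread (`|a| + `|b|)) => n [_ _ _]; apply.
      by rewrite [leRHS]ger0_norm ?addr_ge0// lerDl.
    by rewrite [leRHS]ger0_norm ?addr_ge0// lerDr.
  apply/eqP; rewrite eq_le; apply/andP; split.
    by apply: (cvgr_to_le cd); apply: filterS e => n ->.
  by apply: (cvgr_to_ge cd); apply: filterS e => n ->.
have par t : mdist (c t) (s t) <= 2 * (r0 + 1) + 1.
  by apply: (ulimit_dist_le (hs t)); apply: filterS (spread t) => n [].
have away t : r0 <= mdist (c 0) (s t).
  by apply: (ulimit_dist_ge (hs t)); apply: filterS (spread t) => n [].
have [t0 nt0] := nearest_exists (s 0) lc.
have := hr _ _ ls par _ _ nt0; rewrite ltNge => /negP; apply.
rewrite metric_sym -(parallel_invariant CN geo lc ls par t0 0 (- t0)) subrr.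
exact: away.
Qed.

Theorem passes_near : exists N r : R, forall x y t1 t2 m,
  nearest c x t1 -> nearest c y t2 -> t1 + N <= m -> m + N <= t2 ->
  exists z, mdist x z + mdist z y = mdist x y /\ mdist (c m) z <= r.
Proof.
have [N [r hr]] := passes_near_0.
exists (N + l), (r + l) => x y t1 t2 m nx ny h1 h2.
have [b [psi [/andP[b1 b2] p1 p2]]] := rc m.
have [||z [z1 z2]] := hr _ _ _ _ (nearest_recenter p1 p2 nx) (nearest_recenter p1 p2 ny).
- by lra.
- by lra.
have [u u01 du] := between_divides z1.
have [z' dz'] := divides_exists geo x y u01.
exists z'; split; first by case: dz' => -> ->; ring.
have zE : z = psi z'.
  apply: (divides_uniq CN u01 du).
  by case: dz' => e1 e2; split; rewrite !p1.
have : mdist (c b) z' <= r.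
  by move: z2; rewrite zE -p2 p1 add0r.
have := metric_triangle (c m) (c b) z'; rewrite lc distrC ger0_norm ?subr_ge0//.
lra.
Qed.

End Passing.

(** * Independent rank one isometries *)

Section Axis.
Variables (R : realType) (X : metricType R).

Lemma axis_recentering (f : X -> X) (c : R -> X) l : isometry f -> 0 < l ->
  (forall t, f (c t) = c (t + l)) -> recentering c l.
Proof.
move=> [fi fs] l0 fc.
have [g gK] := choice fs.
have gi x y : mdist (g x) (g y) = mdist x y by rewrite -fi !gK.
have gc t : g (c (t + l)) = c t.
  by apply: mdist_positivity; rewrite -fi gK fc mdistxx.
pose P b := exists psi : X -> X, (forall x y, mdist (psi x) (psi y) = mdist x y) /\
      forall t, psi (c (t + b)) = c t.
have Pn (n : nat) : P (n%:R * l) /\ P (- (n%:R * l)).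
  elim: n => [|n [[p [p1 p2]] [q [q1 q2]]]].
    by rewrite mul0r oppr0; split; exists id; split=> // t; rewrite addr0.
  split.
    exists (p \o g); split=> [x y|t] /=; first by rewrite p1.
    by rewrite mulrS mulrDl mul1r addrCA addrC gc p2.
  exists (q \o f); split=> [x y|t] /=; first by rewrite q1.
  by rewrite fc -[RHS]q2; congr (q (c _)); rewrite mulrS; ring.
move=> a; pose k := Num.floor (a / l) + 1.
have [k1 k2] : a <= k%:~R * l /\ k%:~R * l <= a + l.
  have /andP[h1 h2] := floor_itv (a / l).
  rewrite -ler_pdivrMr// /k intrD; split; first by apply: ltW; rewrite intrD in h2.
  by rewrite mulrDl mul1r lerD2r -ler_pdivlMr.
have : P (k%:~R * l).
  case: k {k1 k2} => n; first by case: (Pn n).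
  by rewrite NegzE mulrNz mulNr; case: (Pn n.+1).
by move=> [psi [p1 p2]]; exists (k%:~R * l), psi; split=> //; apply/andP.
Qed.

Lemma nearest_shift (f : X -> X) (c : R -> X) l x s n : isometry f ->
  (forall t, f (c t) = c (t + l)) -> nearest c x s ->
  nearest c (iter n f x) (s + n%:R * l).
Proof.
move=> [fi _] fc; elim: n => [|n IH] ns; first by rewrite mul0r addr0.
have h := IH ns => t /=.
have e u : c u = f (c (u - l)) by rewrite fc subrK.
rewrite (e t) e !fi; have := h (t - l).
by rewrite mulrS mulrDl mul1r; congr (mdist _ (c _) <= _); ring.
Qed.

Lemma asymptotic_sym (c c' : R -> X) : asymptotic c c' -> asymptotic c' c.
Proof. by move=> [K hK]; exists K => t t0; rewrite metric_sym; exact: hK. Qed.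

Lemma asymptotic_trans (c c' d : R -> X) :
  asymptotic c c' -> asymptotic c' d -> asymptotic c d.
Proof.
move=> [K hK] [L hL]; exists (K + L) => t t0.
by apply: (le_trans (metric_triangle _ (c' t) _)); apply: lerD; [exact: hK|exact: hL].
Qed.

Lemma asymptotic_endpoint (c c' : R -> X) : asymptotic c c' ->
  endpoint c = endpoint c'.
Proof.
move=> a; apply/seteqP; split=> d [d1 d2]; split=> //.
  exact: asymptotic_trans (asymptotic_sym a) d2.
exact: asymptotic_trans a d2.
Qed.

(** The conclusion of [passes_near]; the part of [c] between the two nearest
    points is followed up to [r]. *)
Definition contracting (c : R -> X) := exists N r : R, forall x y t1 t2 m,
  nearest c x t1 -> nearest c y t2 -> t1 + N <= m -> m + N <= t2 ->
  exists z, mdist x z + mdist z y = mdist x y /\ mdist (c m) z <= r.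

Hypothesis CN : CN_inequality X.
Hypothesis geo : geodesic_space X.
Hypothesis pX : proper_space X.

Lemma nearest_self (c : R -> X) t : nearest c (c t) t.
Proof. by move=> u; rewrite mdistxx mdist_ge0. Qed.

(** If a point [x] projects far away on both lines, then the geodesics from
    [c 0] and from [c' 0] to [x] follow [c] and [c'] for a long time, and they
    remain close to each other. When such points exist for all bounds, the two
    rays are asymptotic. *)
Lemma nearest_bounded_on_one (c c' : R -> X) : geodesic_line c -> geodesic_line c' ->
  contracting c -> contracting c' -> ~ asymptotic c c' ->
  exists B : R, forall x s s', nearest c x s -> nearest c' x s' ->
    s <= B \/ s' <= B.
Proof.
move=> lc lc' [N [r hc]] [N' [r' hc']] na; apply: contrapT => hB; apply: na.
pose d := mdist (c 0) (c' 0); pose M := `|N| + `|N'|.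
exists (2 * M + (2 * r + 2 * r' + 3 * d)) => t t0.
have M1 : N <= M by rewrite /M; have := ler_norm N; have := normr_ge0 N'; lra.
have M2 : N' <= M by rewrite /M; have := ler_norm N'; have := normr_ge0 N; lra.
have M0 : 0 <= M by rewrite addr_ge0.
have [x [s [s' [ns ns' sB s'B]]]] : exists x s s',
    [/\ nearest c x s, nearest c' x s', t + 2 * M < s & t + 2 * M < s'].
  apply: contrapT => h; apply: hB; exists (t + 2 * M) => x s s' ns ns'.
  have [h1|h1] := leP s (t + 2 * M); first by left.
  have [h2|h2] := leP s' (t + 2 * M); first by right.
  by exfalso; apply: h; exists x, s, s'.
pose m := t + M.
have [||z [z1 z2]] := hc _ _ _ _ m (nearest_self c 0) ns; [rewrite /m; lra..|].
have [||z' [z1' z2']] := hc' _ _ _ _ m (nearest_self c' 0) ns'; [rewrite /m; lra..|].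
have [u u01 du] := between_divides z1.
have [w dw] := divides_exists geo (c' 0) x u01.
have e1 : mdist z w <= d.
  have := convex_dist CN geo u01 du dw; rewrite mdistxx mulr0 addr0.
  move=> /le_trans; apply; apply: ler_piMl; first exact: mdist_ge0.
  by case/andP: u01; lra.
have bw : mdist (c' 0) w + mdist w x = mdist (c' 0) x by case: dw => -> ->; ring.
have e2 := between_same CN geo bw z1'.
have cm : mdist (c 0) (c m) = m by rewrite lc sub0r normrN ger0_norm// /m; lra.
have cm' : mdist (c' 0) (c' m) = m by rewrite lc' sub0r normrN ger0_norm// /m; lra.
have e3 : mdist w z' <= 2 * d + r + r'.
  rewrite e2 ler_norml.
  have := metric_triangle (c 0) z (c m); rewrite cm (metric_sym z).
  have := metric_triangle (c 0) (c m) z; rewrite cm.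
  have := metric_triangle (c' 0) z' (c' m); rewrite cm' (metric_sym z').
  have := metric_triangle (c' 0) (c' m) z'; rewrite cm'.
  have := metric_triangle (c' 0) z w; have := metric_triangle (c' 0) (c 0) z.
  have := metric_triangle (c 0) w z; have := metric_triangle (c 0) (c' 0) w.
  rewrite (metric_sym w z) (metric_sym (c' 0) (c 0)) -/d.
  by move=> *; apply/andP; split; lra.
have := metric_triangle (c t) (c m) (c' t); have := metric_triangle (c m) z (c' t).
have := metric_triangle z w (c' t); have := metric_triangle w z' (c' t).
have := metric_triangle z' (c' m) (c' t).
rewrite lc lc' (metric_sym z' (c' m)).
have -> : t - m = - M by rewrite /m; ring.
have -> : m - t = M by rewrite /m; ring.
rewrite normrN ger0_norm//; lra.
Qed.

Lemma independent_axes (f h : X -> X) : independent_rank_one f h ->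
  exists c c' l l', [/\ geodesic_line c /\ geodesic_line c', contracting c,
    0 < l /\ 0 < l', (forall t, f (c t) = c (t + l)) /\ (forall t, h (c' t) = c' (t + l')) &
    exists B : R, forall x s s', nearest c x s -> nearest c' x s' ->
      `|s| <= B \/ `|s'| <= B].
Proof.
move=> [[fi [c [lc [l l0 fc]] nb]] [hi [c' [lc' [l' l'0 hc']] nb']] dis].
have rc := axis_recentering fi l0 fc; have rc' := axis_recentering hi l'0 hc'.
have kc : contracting c := passes_near CN geo pX lc rc nb.
have kc' : contracting c' := passes_near CN geo pX lc' rc' nb'.
have krev (d : R -> X) k : geodesic_line d -> recentering d k ->
    ~ bounds_flat_half_plane d -> contracting (reversed d).
  move=> ld rd nd; apply: (passes_near CN geo pX (geodesic_line_rev ld) (recentering_rev rd)).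
  by move=> hd; exact/nd/bounds_flat_half_plane_rev.
have kr := krev _ _ lc rc nb; have kr' := krev _ _ lc' rc' nb'.
have lr := geodesic_line_rev lc; have lr' := geodesic_line_rev lc'.
have na d d' : (d = c \/ d = reversed c) -> (d' = c' \/ d' = reversed c') ->
    ~ asymptotic d d'.
  move=> hd hd' /asymptotic_endpoint e.
  have : (axis_endpoints f `&` axis_endpoints h) (endpoint d).
    split.
      exists c; first by split=> //; exists l.
      by case: hd => ->; [left|right].
    exists c'; first by split=> //; exists l'.
    by rewrite e; case: hd' => ->; [left|right].
  by rewrite dis.
exists c, c', l, l'; split=> //.
have [B1 h1] := nearest_bounded_on_one lc lc' kc kc' (na _ _ (or_introl erefl) (or_introl erefl)).
have [B2 h2] := nearest_bounded_on_one lc lr' kc kr' (na _ _ (or_introl erefl) (or_intror erefl)).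
have [B3 h3] := nearest_bounded_on_one lr lc' kr kc' (na _ _ (or_intror erefl) (or_introl erefl)).
have [B4 h4] := nearest_bounded_on_one lr lr' kr kr' (na _ _ (or_intror erefl) (or_intror erefl)).
exists (Num.max (Num.max B1 B2) (Num.max B3 B4)) => x s s' ns ns'.
set B := Num.max _ _.
have [m1 m2 m3 m4] : [/\ B1 <= B, B2 <= B, B3 <= B & B4 <= B].
  by rewrite /B !le_max !lexx !orbT.
have g1 := h1 _ _ _ ns ns'; have g2 := h2 _ _ _ ns (nearest_rev ns').
have g3 := h3 _ _ _ (nearest_rev ns) ns'.
have g4 := h4 _ _ _ (nearest_rev ns) (nearest_rev ns').
apply: contrapT => /not_orP[]; rewrite !ler_norml => /negP k1 /negP k2.
move: k1 k2; rewrite !negb_and -!ltNge => /orP[k1|k1] /orP[k2|k2].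
- by case: g4; lra.
- by case: g3; lra.
- by case: g2; lra.
- by case: g1; lra.
Qed.

(** Call [x] good when its nearest point on the axis of [f] is near the origin of
    the axis. If it is not, then its nearest point on the axis of [h] is near the
    origin, and a power of [h] that translates by more than the diameter of this
    neighbourhood takes it out: among [x], [h^P x] and [h^(2P) x] at most one is
    not good. A large power of [f] then separates the nearest points of two good
    points. *)
Lemma schottky_factor (f h : X -> X) : independent_rank_one f h ->
  exists (good : X -> Prop) (p : X) (r : R) (P0 Q0 : nat),
    (forall P x, (P0 <= P)%N -> exists j0, forall j, (j <= 2)%N -> j != j0 ->
       good (iter (j * P) h x)) /\
    (forall Q x y, (Q0 <= Q)%N -> good x -> good y -> exists z,
       mdist x z + mdist z (iter Q f y) = mdist x (iter Q f y) /\ mdist p z <= r).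
Proof.
move=> ind; have [fi hi] : isometry f /\ isometry h by case: ind => [[? _] [? _] _].
have [c [c' [l [l' [[lc lc'] [N [r kc]] [l0 l'0] [fc hc'] [B hB]]]]]] := independent_axes ind.
have [P0 hP0] := nat_above ((2 * `|B| + 1) / l').
have [Q0 hQ0] := nat_above ((2 * B + 2 * N) / l).
exists (fun x => exists2 s, nearest c x s & `|s| <= B), (c (B + N)), r, P0, Q0; split.
- move=> P x PP; have [s' ns'] := nearest_exists x lc'.
  pose good j := exists2 s, nearest c (iter (j * P) h x) s & `|s| <= B.
  have bad j : ~ good j -> `|s' + (j * P)%:R * l'| <= B.
    move=> nj; have [s ns] := nearest_exists (iter (j * P) h x) lc.
    have [sB|//] := hB _ _ _ ns (nearest_shift (j * P) hi hc' ns').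
    by exfalso; apply: nj; exists s.
  have PB : 2 * B < P%:R * l'.
    have : (2 * `|B| + 1) / l' <= P%:R by rewrite (le_trans hP0)// ler_nat.
    by rewrite ler_pdivrMr//; have := ler_norm B; lra.
  have uniq j k : (j < k)%N -> ~ good j -> ~ good k -> False.
    move=> jk /bad hj /bad hk.
    have : (k * P)%:R * l' - (j * P)%:R * l' <= 2 * B.
      by move: hj hk; rewrite !ler_norml => /andP[? ?] /andP[? ?]; lra.
    rewrite -mulrBl -natrB ?leq_mul2r ?(ltnW jk) ?orbT// -mulnBl natrM -mulrA.
    rewrite leNgt => /negP; apply; apply: (lt_le_trans PB).
    have B0 : 0 <= B by apply: le_trans hj; exact: normr_ge0.
    by apply: ler_peMl; [lra|rewrite ler1n subn_gt0].
  have [[j0 [_ hj0]]|hn] := pselect (exists j0, (j0 <= 2)%N /\ ~ good j0).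
    exists j0 => j j2 jj0; apply: contrapT => hj.
    by move: jj0; rewrite neq_ltn => /orP[h1|h1]; [exact: (uniq j j0)|exact: (uniq j0 j)].
  (* Any value above 2 will do when no exponent is bad. *)
  by exists 5%N => j j2 _; apply: contrapT => hj; apply: hn; exists j.
- move=> Q x y QQ [s ns sB] [t nt tB].
  apply: (kc _ _ _ _ _ ns (nearest_shift Q fi fc nt)).
    by move: sB; rewrite ler_norml => /andP[_]; rewrite lerD2r.
  have : 2 * B + 2 * N <= Q%:R * l.
    by rewrite -ler_pdivrMr// (le_trans hQ0)// ler_nat.
  by move: tB; rewrite ler_norml => /andP[? _]; lra.
Qed.

End Axis.

Section GenericProduct.
Variables (R : realType) (X1 X2 : metricType R).
Variable G : set ((X1 -> X1) * (X2 -> X2)).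
Hypothesis hG : isometry_subgroup G.
Hypothesis CN1 : CN_inequality X1.
Hypothesis geo1 : geodesic_space X1.
Hypothesis pX1 : proper_space X1.
Hypothesis CN2 : CN_inequality X2.
Hypothesis geo2 : geodesic_space X2.
Hypothesis pX2 : proper_space X2.

Definition nearly_between (X : metricType R) (C : R) (o x y : X) :=
  exists z, mdist x z + mdist z y = mdist x y /\ mdist o z <= C.

Lemma iter_in_G g n : G g -> G (iter n g.1, iter n g.2).
Proof.
have [_ G1 GM _] := hG; move=> Gg; elim: n => [|n IH] //.
exact: (GM _ _ Gg IH).
Qed.

Lemma third_choice (a b : nat) : exists j, [/\ (j <= 2)%N, j != a & j != b].
Proof.
have [|h0] := boolP ((0%N != a) && (0%N != b)); first by case/andP; exists 0%N.
have [|h1] := boolP ((1%N != a) && (1%N != b)); first by case/andP; exists 1%N.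
exists 2%N; split=> //; apply/negP => /eqP e; subst.
  by move: h0 h1; rewrite /= !negbK => /eqP <-.
by move: h0 h1; rewrite /= !andbT !negbK => /eqP <-.
Qed.

(** Each factor excludes at most one of three exponents of [h], so that one
    exponent makes both coordinates of a given point good. The elements are
    [h^(-j P) g^Q h^(k P)] for [j, k <= 2]. *)
Theorem generic_product (o : X1 * X2) (g h : (X1 -> X1) * (X2 -> X2)) : G g -> G h ->
  independent_rank_one g.1 h.1 -> independent_rank_one g.2 h.2 ->
  exists (I : finType) (lam : I -> (X1 -> X1) * (X2 -> X2)) (C : R),
    (forall e, G (lam e)) /\
    forall x y : X1 * X2, exists e,
      nearly_between C o.1 x.1 ((lam e).1 y.1) /\
      nearly_between C o.2 x.2 ((lam e).2 y.2).
Proof.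
move=> Gg Gh ind1 ind2; have [Giso _ GM Ginv] := hG.
have [good1 [p1 [r1 [P1 [Q1 [hP1 hQ1]]]]]] := schottky_factor CN1 geo1 pX1 ind1.
have [good2 [p2 [r2 [P2 [Q2 [hP2 hQ2]]]]]] := schottky_factor CN2 geo2 pX2 ind2.
pose P := maxn P1 P2; pose Q := maxn Q1 Q2.
pose H (j : nat) := (iter (j * P) h.1, iter (j * P) h.2).
pose F := (iter Q g.1, iter Q g.2).
have GH j : G (H j) by exact: iter_in_G.
have GF : G F by exact: iter_in_G.
have Hinv j : exists a, G a /\ cancel (H j).1 a.1 /\ cancel (H j).2 a.2.
  by have [a Ga [? _ ? _]] := Ginv _ (GH j); exists a.
have [a ha] := choice Hinv.
pose lam (e : 'I_3 * 'I_3) := ((a e.1).1 \o (F.1 \o (H e.2).1), (a e.1).2 \o (F.2 \o (H e.2).2)).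
pose C := \sum_(j < 3) (`|mdist ((H j).1 o.1) p1 + r1| + `|mdist ((H j).2 o.2) p2 + r2|).
have pick (x : X1 * X2) : exists j : 'I_3, good1 ((H j).1 x.1) /\ good2 ((H j).2 x.2).
  have [j1 h1] := hP1 P x.1 (leq_maxl _ _); have [j2 h2] := hP2 P x.2 (leq_maxr _ _).
  have [j [j3 jj1 jj2]] := third_choice j1 j2.
  have jo : (j < 3)%N by [].
  by exists (Ordinal jo); split; [exact: h1|exact: h2].
exists _, lam, C; split=> [e|x y].
  have [Ga _] := ha e.1; exact: (GM _ _ Ga (GM _ _ GF (GH e.2))).
have [j [gj1 gj2]] := pick x; have [k [gk1 gk2]] := pick y.
have [z1 [b1 d1]] := hQ1 Q _ _ (leq_maxl _ _) gj1 gk1.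
have [z2 [b2 d2]] := hQ2 Q _ _ (leq_maxr _ _) gj2 gk2.
have [Ga [K1 K2]] := ha j; have [[A1 _] [A2 _]] := Giso _ Ga.
have jC : `|mdist ((H j).1 o.1) p1 + r1| + `|mdist ((H j).2 o.2) p2 + r2| <= C.
  by rewrite /C (bigD1 j)//= lerDl sumr_ge0// => i _; rewrite addr_ge0.
exists (j, k); split.
  exists ((a j).1 z1); rewrite -{1 2}(K1 x.1) /= !A1 b1; split=> //.
  rewrite -(K1 o.1) A1; apply: le_trans jC.
  apply: (le_trans (metric_triangle _ p1 _)).
  by have := ler_norm (mdist ((H j).1 o.1) p1 + r1);
     have := normr_ge0 (mdist ((H j).2 o.2) p2 + r2); lra.
exists ((a j).2 z2); rewrite -{1 2}(K2 x.2) /= !A2 b2; split=> //.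
rewrite -(K2 o.2) A2; apply: le_trans jC.
apply: (le_trans (metric_triangle _ p2 _)).
by have := ler_norm (mdist ((H j).2 o.2) p2 + r2);
   have := normr_ge0 (mdist ((H j).1 o.1) p1 + r1); lra.
Qed.

End GenericProduct.

(** * Counting products *)

Lemma image_count (A : finType) (T : Type) (F : A -> T) (K : nat) :
  (forall a0, (#|[set a | `[< F a = F a0 >]]%SET| <= K)%N) ->
  exists n (f : 'I_n -> T), [/\ injective f, forall i, exists a, f i = F a &
    (#|A| <= n * K)%N].
Proof.
move=> hK; pose r a := odflt a [pick b | `[< F b = F a >]].
have Fr a : F (r a) = F a.
  rewrite /r; case: pickP => [b /asboolP //|/(_ a)].
  by move=> /asboolP.
have rF a b : F a = F b -> r a = r b.
  move=> e; rewrite /r.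
  rewrite (@eq_pick _ _ (fun c => `[< F c = F b >])); last by move=> c /=; rewrite e.
  by case: pickP => // /(_ b) /asboolP.
pose Q := (r @: [set: A]%SET)%SET.
exists #|Q|, (fun i => F (enum_val i)); split.
- move=> i j e; apply: enum_val_inj.
  have fixed k : r (enum_val (k : 'I_#|Q|)) = enum_val k.
    by have /imsetP[a _ ->] := enum_valP k; apply: rF; rewrite Fr.
  by rewrite -fixed -[RHS]fixed; exact: rF.
- by move=> i; exists (enum_val i).
rewrite -cardsT -sum1_card (partition_big_imset r) /= -sum_nat_const.
apply: leq_sum => q _; rewrite sum1dep_card.
apply: leq_trans (hK q); apply: subset_leq_card; apply/fintype.subsetP => a.
by rewrite !inE /= => /eqP <-; rewrite Fr.
Qed.

Section Counting.
Variables (R : realType) (X1 X2 : metricType R).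
Variable G : set ((X1 -> X1) * (X2 -> X2)).
Hypothesis hG : isometry_subgroup G.
Hypothesis pG : acts_properly G.
Hypothesis CN1 : CN_inequality X1.
Hypothesis geo1 : geodesic_space X1.
Hypothesis CN2 : CN_inequality X2.
Hypothesis geo2 : geodesic_space X2.
Variable o : X1 * X2.

Let d1 (g : (X1 -> X1) * (X2 -> X2)) : R := mdist o.1 (g.1 o.1).
Let d2 (g : (X1 -> X1) * (X2 -> X2)) : R := mdist o.2 (g.2 o.2).

Lemma product_dist_le (g : (X1 -> X1) * (X2 -> X2)) :
  product_dist o (act g o) <= d1 g + d2 g.
Proof.
rewrite /product_dist /act /= -/(d1 g) -/(d2 g).
have h1 : 0 <= d1 g by exact: mdist_ge0. have h2 : 0 <= d2 g by exact: mdist_ge0.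
rewrite -[leRHS]ger0_norm ?addr_ge0// -sqrtr_sqr ler_wsqrtr//.
by rewrite sqrrD lerD2r lerDl mulrn_wge0// mulr_ge0.
Qed.

Lemma finite_code (rho : R) : exists (K : nat) (code : (X1 -> X1) * (X2 -> X2) -> nat),
  (forall g, G g -> d1 g + d2 g <= rho -> (code g < K)%N) /\
  (forall g h, G g -> G h -> d1 g + d2 g <= rho -> d1 h + d2 h <= rho ->
     code g = code h -> g = h).
Proof.
have r0 : 0 < `|rho| + 1 by rewrite ltr_wpDl.
have /finite_setP[n /card_set_bijP[code [cfun cinj _]]] := pG o r0.
have mem g : G g -> d1 g + d2 g <= rho ->
    [set g | G g /\ product_dist o (act g o) <= `|rho| + 1] g.
  move=> Gg gr; split=> //; apply: (le_trans (product_dist_le g)).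
  by apply: (le_trans gr); have := ler_norm rho; lra.
exists n, code; split=> [g Gg gr|g h Gg Gh gr hr e].
  exact: (cfun _ (mem g Gg gr)).
by apply: cinj e; rewrite inE; exact: mem.
Qed.

Section Step.
Variables (I : finType) (lam : I -> (X1 -> X1) * (X2 -> X2)) (C : R).
Hypothesis Glam : forall e, G (lam e).
Hypothesis lamP : forall x y : X1 * X2, exists e,
      nearly_between C o.1 x.1 ((lam e).1 y.1) /\
      nearly_between C o.2 x.2 ((lam e).2 y.2).

(** The point [z] of the geodesic from [p] to [s (k (w p))] is near [s p], so that
    the triangle inequality at [s p] is almost an equality. *)
Lemma product_dist_bounds (X : metricType R) (p : X) (s k w : X -> X) z (L : R) :
  isometry s -> isometry k -> mdist p (k p) <= L ->
  mdist p z + mdist z (s (k (w p))) = mdist p (s (k (w p))) -> mdist (s p) z <= C ->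
  `|mdist p (s (k (w p))) - (mdist p (s p) + mdist p (w p))| <= 2 * C + L.
Proof.
move=> [si _] [ki _] kL hz zC; rewrite ler_norml.
have c0 : 0 <= C by apply: le_trans zC; exact: mdist_ge0.
have t1 := metric_triangle p (s p) (s (k (w p))); rewrite si in t1.
have t2 := metric_triangle p (k p) (k (w p)); rewrite ki in t2.
have t3 := metric_triangle p z (s p); rewrite (metric_sym z (s p)) in t3.
have t4 := metric_triangle (s p) z (s (k (w p))); rewrite si in t4.
have t5 := metric_triangle (k p) p (k (w p)).
rewrite ki (metric_sym (k p) p) in t5.
by apply/andP; split; lra.
Qed.

Lemma shifted_product (s w : (X1 -> X1) * (X2 -> X2)) : G s -> exists e,
  (exists z, mdist o.1 z + mdist z (s.1 ((lam e).1 (w.1 o.1))) =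
      mdist o.1 (s.1 ((lam e).1 (w.1 o.1))) /\ mdist (s.1 o.1) z <= C) /\
  (exists z, mdist o.2 z + mdist z (s.2 ((lam e).2 (w.2 o.2))) =
      mdist o.2 (s.2 ((lam e).2 (w.2 o.2))) /\ mdist (s.2 o.2) z <= C).
Proof.
move=> Gs; have [Giso _ _ Ginv] := hG.
have [t _ [K1 K1' K2 K2']] := Ginv _ Gs; have [[i1 _] [i2 _]] := Giso _ Gs.
have [e [[z1 [b1 c1]] [z2 [b2 c2]]]] := lamP (act t o) (act w o).
exists e; split.
  exists (s.1 z1); rewrite !i1; split=> //.
  by rewrite -{1 3}(K1' o.1) !i1; exact: b1.
exists (s.2 z2); rewrite !i2; split=> //.
by rewrite -{1 3}(K2' o.2) !i2; exact: b2.
Qed.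

(** Elements are counted by injections from an ordinal, which compose with the
    injective choices made in the proofs. *)
Definition many (n : nat) (v1 v2 E : R) := exists f : 'I_n -> (X1 -> X1) * (X2 -> X2),
  injective f /\ forall i, [/\ G (f i), `|d1 (f i) - v1| <= E & `|d2 (f i) - v2| <= E].

Lemma isometry_inj (X : metricType R) (f : X -> X) : isometry f -> injective f.
Proof. by move=> [fi _] x y e; apply: mdist_positivity; rewrite -fi e mdistxx. Qed.

(** The points [z] and [z'] lie on the same geodesic, at almost the same distance
    of [p]. *)
Lemma close_factors (X : metricType R) (CN : CN_inequality X) (geo : geodesic_space X)
  (p : X) (s t : X -> X) y z z' (a : R) :
  mdist p z + mdist z y = mdist p y -> mdist p z' + mdist z' y = mdist p y ->
  mdist (s p) z <= C -> mdist (t p) z' <= C ->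
  `|mdist p (s p) - a| <= 1 -> `|mdist p (t p) - a| <= 1 ->
  mdist (s p) (t p) <= 4 * C + 2.
Proof.
move=> b b' sz tz; rewrite !ler_norml => /andP[s1 s2] /andP[t1 t2].
have e : mdist z z' <= 2 * C + 2.
  rewrite (between_same CN geo b b') ler_norml.
  have := metric_triangle p (s p) z; have := metric_triangle p z (s p).
  have := metric_triangle p (t p) z'; have := metric_triangle p z' (t p).
  rewrite (metric_sym z (s p)) (metric_sym z' (t p)) => *.
  by apply/andP; split; lra.
have := metric_triangle (s p) z (t p); have := metric_triangle z z' (t p).
by rewrite (metric_sym z' (t p)); lra.
Qed.

(** In a fibre of [(s, w) |-> s lam w], the elements [s] differ from one another
    by elements of bounded displacement, and [s] together with [lam] determines
    [w]. The constants do not depend on the size [E] of the second box, which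
    allows to iterate. *)
Lemma count_step : exists (K : nat) (D : R), (0 < K)%N /\ 0 <= D /\
  forall n a1 a2 m v1 v2 E, many n a1 a2 1 -> many m v1 v2 E ->
  exists k, many k (a1 + v1) (a2 + v2) (E + D) /\ (n * m <= k * K)%N.
Proof.
have [Giso _ GM Ginv] := hG.
have [K0 [code [codelt codeinj]]] := finite_code (2 * (4 * C + 2)).
pose L := \sum_(e : I) (d1 (lam e) + d2 (lam e)).
have Le e : d1 (lam e) <= L /\ d2 (lam e) <= L.
  have : d1 (lam e) + d2 (lam e) <= L.
    by rewrite /L (bigD1 e)//= lerDl sumr_ge0// => i _; rewrite addr_ge0// mdist_ge0.
  have h1 : 0 <= d1 (lam e) by exact: mdist_ge0.
  have h2 : 0 <= d2 (lam e) by exact: mdist_ge0.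
  lra.
have C0 : 0 <= C.
  have [e [[z [_ h]] _]] := lamP o o; apply: le_trans h; exact: mdist_ge0.
have L0 : 0 <= L by apply: sumr_ge0 => i _; rewrite addr_ge0// mdist_ge0.
exists (K0.+1 * #|{: I}|.+1)%N, (2 * C + L + 1); split; first by rewrite muln_gt0.
split; first by lra.
move=> n a1 a2 m v1 v2 E [fS [Sinj hS]] [fW [Winj hW]].
have GS i : G (fS i) by case: (hS i). have GW i : G (fW i) by case: (hW i).
have he (a : 'I_n * 'I_m) := shifted_product (fW a.2) (GS a.1).
have [e hE] := choice he.
pose F (a : 'I_n * 'I_m) := ((fS a.1).1 \o ((lam (e a)).1 \o (fW a.2).1),
                            (fS a.1).2 \o ((lam (e a)).2 \o (fW a.2).2)).
have GF a : G (F a) by exact: (GM _ _ (GS _) (GM _ _ (Glam _) (GW _))).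
have fib a0 : (#|[set a | `[< F a = F a0 >]]%SET| <= K0.+1 * #|{: I}|.+1)%N.
  have [t Gt [K1 K1' K2 K2']] := Ginv _ (GS a0.1).
  have [[ti1 _] [ti2 _]] := Giso _ Gt.
  pose q (a : 'I_n * 'I_m) := (t.1 \o (fS a.1).1, t.2 \o (fS a.1).2).
  have Gq a : G (q a) by exact: (GM _ _ Gt (GS _)).
  have qs a : F a = F a0 -> d1 (q a) + d2 (q a) <= 2 * (4 * C + 2).
    move=> Fa; have [E1 E2] : (F a).1 o.1 = (F a0).1 o.1 /\ (F a).2 o.2 = (F a0).2 o.2.
      by rewrite Fa.
    have [[z [z1 z2]] [z' [z1' z2']]] := hE a.
    have [[y [y1 y2]] [y' [y1' y2']]] := hE a0.
    rewrite -[(fS a.1).1 _]/((F a).1 o.1) E1 in z1.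
    rewrite -[(fS a.1).2 _]/((F a).2 o.2) E2 in z1'.
    have [_ s1 s2] := hS a.1; have [_ r1 r2] := hS a0.1.
    have h1 := close_factors CN1 geo1 z1 y1 z2 y2 s1 r1.
    have h2 := close_factors CN2 geo2 z1' y1' z2' y2' s2 r2.
    have -> : d1 (q a) = mdist ((fS a.1).1 o.1) ((fS a0.1).1 o.1).
      by rewrite /d1 /= -{1}(K1 o.1) ti1 metric_sym.
    have -> : d2 (q a) = mdist ((fS a.1).2 o.2) ((fS a0.1).2 o.2).
      by rewrite /d2 /= -{1}(K2 o.2) ti2 metric_sym.
    lra.
  pose phi (a : 'I_n * 'I_m) : 'I_K0.+1 * option I := (inord (code (q a)), Some (e a)).
  rewrite -(@card_in_imset _ _ phi).
    apply: (leq_trans (max_card _)).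
    by rewrite card_prod card_ord card_option.
  have cl a : F a = F a0 -> (code (q a) < K0.+1)%N.
    by move=> h; apply: leqW; apply: codelt => //; exact: qs.
  move=> a b; rewrite !inE => Fa Fb [].
  move=> /(congr1 val); rewrite /= !inordK ?cl//.
  move=> ce ee.
  have qab : q a = q b by apply: codeinj ce => //; exact: qs.
  have S12 : a.1 = b.1.
    apply: Sinj.
    have [q1 q2] : (q a).1 = (q b).1 /\ (q a).2 = (q b).2 by rewrite qab.
    rewrite [LHS]surjective_pairing [RHS]surjective_pairing; congr (_, _).
      by apply/funext => x; apply: (can_inj K1'); exact: (congr1 (fun f => f x) q1).
    by apply/funext => x; apply: (can_inj K2'); exact: (congr1 (fun f => f x) q2).
  have W12 : a.2 = b.2.
    apply: Winj; have Fab : F a = F b by rewrite Fa Fb.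
    have [q1 q2] : (F a).1 = (F b).1 /\ (F a).2 = (F b).2 by rewrite Fab.
    have [i1 i2] := Giso _ (GS b.1); have [j1 j2] := Giso _ (Glam (e b)).
    rewrite [LHS]surjective_pairing [RHS]surjective_pairing; congr (_, _).
      apply/funext => x; apply: (isometry_inj j1); apply: (isometry_inj i1).
      by have := congr1 (fun f => f x) q1; rewrite /F /= S12 ee.
    apply/funext => x; apply: (isometry_inj j2); apply: (isometry_inj i2).
    by have := congr1 (fun f => f x) q2; rewrite /F /= S12 ee.
  by rewrite [LHS]surjective_pairing [RHS]surjective_pairing S12 W12.
have [k [f [finj ff kK]]] := image_count fib.
exists k; split; last by rewrite card_prod !card_ord in kK.
exists f; split=> // i; have [a ->] := ff i.
have [[z [z1 z2]] [z' [z1' z2']]] := hE a.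
have [i1 i2] := Giso _ (GS a.1); have [j1 j2] := Giso _ (Glam (e a)).
have [l1 l2] := Le (e a).
have b1 := product_dist_bounds i1 j1 l1 z1 z2.
have b2 := product_dist_bounds i2 j2 l2 z1' z2'.
have [_ s1 s2] := hS a.1; have [_ w1 w2] := hW a.2.
split=> //.
  move: b1 s1 w1; rewrite /d1 /F /= !ler_norml => /andP[? ?] /andP[? ?] /andP[? ?].
  by apply/andP; split; lra.
move: b2 s2 w2; rewrite /d2 /F /= !ler_norml => /andP[? ?] /andP[? ?] /andP[? ?].
by apply/andP; split; lra.
Qed.

Lemma many_1 : many 1 0 0 0.
Proof.
have [_ G1 _ _] := hG.
exists (fun=> (idfun, idfun)); split=> [i j _|i]; first by rewrite !ord1.
by rewrite /d1 /d2 /= !mdistxx subrr normr0 lexx; split.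
Qed.

Lemma count_words : exists K D : R, 1 <= K /\ 0 <= D /\
  forall n a1 a2 m b1 b2, many n a1 a2 1 -> many m b1 b2 1 ->
  forall p q : nat, exists k : nat,
    many k (p%:R * a1 + q%:R * b1) (p%:R * a2 + q%:R * b2) ((p + q)%:R * D) /\
    (n%:R / K) ^+ p * (m%:R / K) ^+ q <= k%:R.
Proof.
have [K [D [K0 [D0 hstep]]]] := count_step.
have KR : 0 < K%:R :> R by rewrite ltr0n.
exists K%:R, D; split; first by rewrite ler1n.
split=> // n a1 a2 m b1 b2 hn hm p q; elim: p => [|p [k [IH1 IH2]]]; last first.
  have [k' [h1 h2]] := hstep _ _ _ _ _ _ _ hn IH1.
  exists k'; split.
    have -> : p.+1%:R * a1 + q%:R * b1 = a1 + (p%:R * a1 + q%:R * b1) by rewrite mulrS; ring.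
    have -> : p.+1%:R * a2 + q%:R * b2 = a2 + (p%:R * a2 + q%:R * b2) by rewrite mulrS; ring.
    by have -> : (p.+1 + q)%:R * D = (p + q)%:R * D + D by rewrite addSn mulrS; ring.
  rewrite exprS -mulrA mulrAC ler_pdivrMr// -natrM.
  apply: le_trans (_ : (n * k)%:R <= _); last by rewrite ler_nat.
  by rewrite natrM ler_wpM2l.
elim: q => [|q [k [IH1 IH2]]].
  by exists 1%N; rewrite !mul0r addr0 !expr0 mulr1; split=> //; exact: many_1.
have [k' [h1 h2]] := hstep _ _ _ _ _ _ _ hm IH1.
exists k'; split.
  have -> : 0%:R * a1 + q.+1%:R * b1 = b1 + (0%:R * a1 + q%:R * b1) by rewrite mulrS; ring.
  have -> : 0%:R * a2 + q.+1%:R * b2 = b2 + (0%:R * a2 + q%:R * b2) by rewrite mulrS; ring.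
  by have -> : (0 + q.+1)%:R * D = (0 + q)%:R * D + D by rewrite !add0n mulrS; ring.
rewrite expr0 mul1r in IH2.
rewrite expr0 mul1r exprS mulrAC ler_pdivrMr// -natrM.
apply: le_trans (_ : (m * k)%:R <= _); last by rewrite ler_nat.
by rewrite natrM ler_wpM2l.
Qed.

End Step.
End Counting.

(** * Growth rates *)

Lemma ereal_real_below (R : realType) (x : \bar R) : x != -oo%E ->
  exists a : R, (a%:E < x)%E.
Proof.
case: x => [r| |] // _; last by exists 0; rewrite ltry.
by exists (r - 1); rewrite lte_fin gtrBl.
Qed.

Lemma ereal_real_between (R : realType) (x y : \bar R) : (x < y)%E ->
  exists a : R, (x < a%:E < y)%E.
Proof.
case: x => [r| |]; case: y => [q| |] //.
- by rewrite lte_fin => rq; exists ((r + q) / 2); rewrite !lte_fin !midf_lt.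
- by move=> _; exists (r + 1); rewrite lte_fin ltrDl ltr01 ltry.
- by move=> _; exists (q - 1); rewrite ltNyr lte_fin gtrBl ltr01.
- by move=> _; exists 0; rewrite ltNyr ltry.
Qed.

Section GrowthRate.
Variables (R : realType) (X1 X2 : metricType R).
Variable G : set ((X1 -> X1) * (X2 -> X2)).
Hypothesis pG : acts_properly G.
Variable o : X1 * X2.

Definition has_many (T : Type) (S : set T) (n : nat) :=
  exists f : 'I_n -> T, injective f /\ forall i, S (f i).

Lemma counting_ge (T : choiceType) (S : set T) n : finite_set S -> has_many S n ->
  (n%:R%:E <= counting S :> \bar R)%E.
Proof.
move=> fS [f [finj fS']]; rewrite /counting asboolT// lee_fin ler_nat.
have -> : n = size [seq f i | i <- enum 'I_n] by rewrite size_map size_enum_ord.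
apply: uniq_leq_size; first by rewrite map_inj_uniq ?enum_uniq.
by move=> x /mapP[i _ ->]; rewrite in_fset_set// inE.
Qed.

Lemma has_many_counting (T : choiceType) (S : set T) : finite_set S ->
  exists2 n, counting S = n%:R%:E :> \bar R & has_many S n.
Proof.
move=> fS; exists (size (finmap.enum_fset (fset_set S))).
  by rewrite /counting asboolT.
exists (fun i => tnth (in_tuple (finmap.enum_fset (fset_set S))) i); split=> [i j|i].
  have /tuple_uniqP ti : uniq (in_tuple (finmap.enum_fset (fset_set S))).
    exact: finmap.fset_uniq.
  exact: ti.
have := mem_tnth i (in_tuple (finmap.enum_fset (fset_set S))).
by rewrite /= in_fset_set// inE.
Qed.

Lemma annulus_finite eps th n : finite_set (orbit_annulus G o eps th n).
Proof.
have r0 : 0 < n%:R + 1 :> R by rewrite ltr_wpDl.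
apply: sub_finite_set (pG o r0) => g [Gg _ /andP[_ h] _]; split=> //.
by apply: ltW; apply: (lt_trans h); rewrite ltrDl.
Qed.

Lemma growth_rate_gt (a eps : R) th (N : nat) : (a%:E < growth_rate G o th)%E -> 0 < eps ->
  exists n k : nat, [/\ (N <= n)%N, (0 < n)%N, expR (a * n%:R) < k%:R &
    has_many (orbit_annulus G o eps th n) k].
Proof.
move=> ha e0; move: ha; rewrite /growth_rate limf_einfE.
move=> /ereal_sup_gt[_ [V Vnear <-] aV].
have [e [Ve e_gt e_lt]] : exists e, [/\ V e, 0 < e & e < eps].
  have := @filter_ex _ (at_right (0 : R)) _ (fun e => V e /\ 0 < e < eps).
  case; first apply: filterI Vnear _; last first.
    by move=> e [Ve /andP[]]; exists e.
  near=> e; apply/andP; split; near: e; first exact: nbhs_right_gt.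
  exact: nbhs_right_lt.
have {}aV : (a%:E < growth_rate_eps G o e th)%E.
  by apply: (lt_le_trans aV); apply: ereal_inf_lbound; exists e.
have sup : (a%:E < ereal_sup [set (lne (counting (orbit_annulus G o e th n)) *
    (n%:R^-1)%:E)%E | n in [set n | (N.+1 <= n)%N]])%E.
  apply: (lt_le_trans aV); rewrite /growth_rate_eps /limn_esup limf_esupE.
  by apply: ereal_inf_lbound; exists [set n | (N.+1 <= n)%N] => //; exists N.+1.
have [_ [n /= Nn <-] an] := ereal_sup_gt sup.
have n0 : (0 < n)%N by apply: leq_trans Nn.
have nR : 0 < n%:R :> R by rewrite ltr0n.
have [k kE [f [finj fA]]] := has_many_counting (annulus_finite e th n).
exists n, k; split=> //; first exact: ltnW.
  move: an; rewrite kE lte_pdivlMr//.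
  have [->|k0] := posnP k; first by rewrite /= lexx.
  rewrite lne_EFin ?ltr0n// -EFinM lte_fin => h.
  by rewrite -[ltRHS]lnK ?posrE ?ltr0n// ltr_expR.
exists f; split=> // i; have [? ? ? h] := fA i; split=> //.
by apply: (le_trans h); exact: ltW.
Unshelve. all: by end_near. Qed.

Lemma growth_rate_lt (t : R) th : (growth_rate G o th < t%:E)%E ->
  exists eps (N : nat), 0 < eps /\ forall n k : nat, (N <= n)%N ->
    has_many (orbit_annulus G o eps th n) k -> k%:R <= expR (t * n%:R).
Proof.
move=> ht; have [eps [e0 he]] : exists eps : R, 0 < eps /\
    (growth_rate_eps G o eps th < t%:E)%E.
  apply: contrapT => h.
  move: ht; rewrite ltNge => /negP; apply; rewrite /growth_rate limf_einfE.
  apply: le_ereal_sup_tmp; exists (ereal_inf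
    [set growth_rate_eps G o x th | x in [set x : R | 0 < x]]).
    by exists [set x : R | 0 < x] => //; exact: nbhs_right_gt.
  apply: le_ereal_inf_tmp => _ [x /= x0 <-]; rewrite leNgt; apply/negP => hx.
  by apply: h; exists x.
exists eps; move: he; rewrite /growth_rate_eps /limn_esup limf_esupE.
move=> /ereal_inf_lt[_ [V [N _ NV] <-] Vt].
exists N.+1; split=> // n k Nn hk.
have n0 : (0 < n)%N by apply: leq_trans Nn.
have nR : 0 < n%:R :> R by rewrite ltr0n.
have := counting_ge (annulus_finite eps th n) hk.
have [j jE _] := has_many_counting (annulus_finite eps th n).
have : (lne (counting (orbit_annulus G o eps th n)) * (n%:R^-1)%:E < t%:E)%E.
  apply: le_lt_trans Vt; apply: ereal_sup_ubound; exists n => //.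
  by apply: NV => /=; exact: ltnW.
rewrite jE lte_pdivrMr// -EFinM lee_fin => h kj; apply: (le_trans kj).
have [->|j0] := posnP j; first exact: expR_ge0.
move: h; rewrite lne_EFin ?ltr0n// lte_fin => h.
by apply: ltW; rewrite -[ltLHS]lnK ?posrE ?ltr0n// ltr_expR.
Qed.

(** The annuli for [th'] and [eps / 2] are contained in those for [th] and
    [eps]. *)
Lemma growth_rate_usc th (a : R) : (growth_rate G o th < a%:E)%E ->
  exists2 e : R, 0 < e & forall th', `|th' - th| <= e -> (growth_rate G o th' <= a%:E)%E.
Proof.
move=> /growth_rate_lt[eps [N [e0 he]]].
have e2 : 0 < eps / 2 by rewrite divr_gt0.
exists (eps / 2) => // th' hth; rewrite leNgt; apply/negP => hgt.
have [n [k [Nn n0 nk [f [finj fA]]]]] := growth_rate_gt N hgt e2.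
suff : has_many (orbit_annulus G o eps th n) k by move=> /(he _ _ Nn); rewrite leNgt nk.
exists f; split=> // i; have [? ? ? h] := fA i; split=> //.
have -> : slope o (f i) - th = (slope o (f i) - th') + (th' - th) by ring.
by rewrite [leRHS]splitr; apply: (le_trans (ler_normD _ _)); exact: lerD.
Qed.

(** The sets where the growth rate exceeds a given number below its supremum
    generate a filter on a compact interval; by upper semicontinuity the supremum
    is attained at each of its cluster points. *)
Lemma growth_rate_attains_max : exists2 th0 : R, 0 <= th0 <= pi / 2 &
  forall th, 0 <= th <= pi / 2 -> (growth_rate G o th <= growth_rate G o th0)%E.
Proof.
pose I := [set th : R | 0 <= th <= pi / 2].
have pi2 : 0 <= pi / 2 :> R by rewrite divr_ge0 ?pi_ge0.
have I0 : I 0 by rewrite /I /= lexx.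
pose M := ereal_sup [set growth_rate G o th | th in I].
have leM th : I th -> (growth_rate G o th <= M)%E.
  by move=> Ith; apply: ereal_sup_ubound; exists th.
suff [th0 Ith0 h0] : exists2 th0, I th0 & (M <= growth_rate G o th0)%E.
  exists th0; first exact: Ith0.
  move=> th hth; apply: (le_trans _ h0); exact: leM.
have [Moo|Mn] := eqVneq M -oo%E; first by exists 0; rewrite ?Moo ?leNye.
pose B (a : R) := I `&` [set th | (a%:E < growth_rate G o th)%E].
pose F := filter_from [set a : R | (a%:E < M)%E] B.
have cI : compact I.
  suff -> : I = [set` `[0 : R, pi / 2]] by exact: segment_compact.
  by apply/seteqP; split=> x; rewrite /I /= in_itv.
have [a0 a0M] : exists a : R, (a%:E < M)%E.
  by apply: ereal_real_below.
have FF : ProperFilter F.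
  apply: filter_from_proper.
    apply: filter_from_filter; first by exists a0.
    move=> a b aM bM; exists (Num.max a b).
      by rewrite /= maxEle; case: ifP.
    move=> th [Ith] /= h; split; split=> //=; apply: le_lt_trans h;
    by rewrite lee_fin le_max lexx ?orbT.
  move=> a aM; have [_ [th Ith <-] h] := ereal_sup_gt aM.
  by exists th.
have FI : F I by exists a0 => // th [].
have [th0 [Ith0 cl]] := cI F FF FI.
exists th0 => //; rewrite leNgt; apply/negP => h.
have [a /andP[ha1 ha2]] : exists a : R, (growth_rate G o th0 < a%:E < M)%E.
  exact: ereal_real_between.
have [e e0 he] := growth_rate_usc ha1.
have [|th [[Ith hth] bth]] := cl (B a) (ball th0 e) _ (nbhsx_ballx _ _ e0).
  by exists a.
move: hth => /=; rewrite ltNge => /negP; apply; apply: he.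
by move: bth; rewrite -ball_normE /= distrC => /ltW.
Qed.

End GrowthRate.

(** * Boxes rich in elements of a given slope *)

Lemma has_many_pigeonhole (T : Type) (S : set T) (k : nat) (B : finType) (phi : T -> B) :
  (0 < k)%N -> has_many S k -> exists b j, [/\ (0 < j)%N,
    has_many (S `&` [set x | phi x = b]) j & (k <= j * #|B|)%N].
Proof.
move=> k0 [f [finj fS]].
pose fib b := [set i : 'I_k | phi (f i) == b]%SET.
pose b0 := phi (f (Ordinal k0)).
have [b _ hb] := @arg_maxnP B b0 xpredT (fun b => #|fib b|) isT.
exists b, #|fib b|; split.
- apply: leq_trans (hb b0 isT).
  by apply/card_gt0P; exists (Ordinal k0); rewrite inE.
- exists (fun i => f (enum_val i)); split=> [i j /finj/enum_val_inj //|i].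
  by split; [exact: fS|have := enum_valP i; rewrite inE => /eqP].
have kE : k = (\sum_(c : B) #|fib c|)%N.
  rewrite -[LHS]card_ord -[LHS]sum1_card (partition_big (fun i => phi (f i)) xpredT) //=.
  by apply: eq_bigr => c _; rewrite -sum1dep_card; apply: eq_bigl => i.
rewrite [leqLHS]kE; apply: (@leq_trans (\sum_(c : B) #|fib b|)%N).
  by apply: leq_sum => c _; exact: hb.
by rewrite big_const iter_addn addn0 leq_mul.
Qed.

(** The cube of [1 + eta n / 3] is below the exponential. *)
Lemma expR_dominates_square (R : realType) (eta : R) : 0 < eta -> exists N : nat,
  forall n : nat, (N <= n)%N -> n.+1%:R ^+ 2 <= expR (eta * n%:R).
Proof.
move=> e0; have [N hN] := nat_above (108 / eta ^+ 3).
exists N.+1 => n Nn.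
have n1 : 1 <= n%:R :> R by rewrite ler1n; apply: leq_trans Nn.
have hn : 108 <= n%:R * eta ^+ 3.
  rewrite -ler_pdivrMr ?exprn_gt0//; apply: (le_trans hN).
  by rewrite ler_nat ltnW.
have h : (eta * n%:R / 3) ^+ 3 <= expR (eta * n%:R).
  have -> : expR (eta * n%:R) = expR (eta * n%:R / 3) ^+ 3.
    by rewrite -expRM_natl; congr expR; field.
  rewrite ler_pXn2r ?nnegrE ?expR_ge0 ?divr_ge0 ?mulr_ge0 ?(ltW e0)//.
  by apply: le_trans (expR_ge1Dx _); rewrite lerDr.
apply: le_trans h.
have -> : (eta * n%:R / 3) ^+ 3 = n%:R ^+ 2 * (n%:R * eta ^+ 3) / 27 by field.
rewrite -natr1.
have h4 : n%:R ^+ 2 * 108 <= n%:R ^+ 2 * (n%:R * eta ^+ 3) by rewrite ler_wpM2l ?sqr_ge0.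
have h5 : (n%:R + 1) ^+ 2 <= 4 * n%:R ^+ 2 :> R.
  by have -> : 4 * n%:R ^+ 2 = (2 * n%:R) ^+ 2 :> R; [ring|
    rewrite ler_pXn2r ?nnegrE ?addr_ge0 ?mulr_ge0//; lra].
rewrite ler_pdivlMr//; lra.
Qed.

Lemma norm2_le (R : realType) (a b c : R) : 0 <= c -> a ^+ 2 + b ^+ 2 <= c ^+ 2 ->
  Num.sqrt (a ^+ 2 + b ^+ 2) <= c.
Proof.
by move=> c0 h; rewrite -[leRHS]ger0_norm// -sqrtr_sqr ler_wsqrtr.
Qed.

Section Boxes.
Variables (R : realType) (X1 X2 : metricType R).
Variable G : set ((X1 -> X1) * (X2 -> X2)).
Hypothesis pG : acts_properly G.
Variable o : X1 * X2.

Let d1 (g : (X1 -> X1) * (X2 -> X2)) : R := mdist o.1 (g.1 o.1).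
Let d2 (g : (X1 -> X1) * (X2 -> X2)) : R := mdist o.2 (g.2 o.2).
Let T := ((X1 -> X1) * (X2 -> X2))%type.

Lemma d_le_product_dist (g : T) :
  d1 g <= product_dist o (act g o) /\ d2 g <= product_dist o (act g o).
Proof.
rewrite /product_dist /act /= -/(d1 g) -/(d2 g).
have h1 : 0 <= d1 g by exact: mdist_ge0. have h2 : 0 <= d2 g by exact: mdist_ge0.
split.
  by rewrite -[leLHS]ger0_norm// -sqrtr_sqr ler_wsqrtr// lerDl sqr_ge0.
by rewrite -[leLHS]ger0_norm// -sqrtr_sqr ler_wsqrtr// lerDr sqr_ge0.
Qed.

(** The integer parts of the two displacements take at most [n.+1] values each. The
    element [g] serves to locate the box. *)
Lemma annulus_box eps th n k : (0 < k)%N -> has_many (orbit_annulus G o eps th n) k ->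
  exists (a1 a2 : nat) j g, [/\ many G o j a1%:R a2%:R 1, (k <= j * (n.+1 * n.+1))%N,
    orbit_annulus G o eps th n g, `|d1 g - a1%:R| <= 1 & `|d2 g - a2%:R| <= 1].
Proof.
move=> k0 hk.
pose phi (g : T) : 'I_n.+1 * 'I_n.+1 := (inord (Num.truncn (d1 g)), inord (Num.truncn (d2 g))).
have [[b1 b2] [j [j0 [f [finj hf]] kj]]] := has_many_pigeonhole phi k0 hk.
have near (d : R) (b : 'I_n.+1) : 0 <= d -> d < n%:R -> inord (Num.truncn d) = b ->
    `|d - b%:R| <= 1.
  move=> d0 dn <-; have /andP[t1 t2] := truncn_itv d0.
  rewrite inordK; last first.
    rewrite ltnS -(ler_nat R); apply: le_trans t1 (ltW dn).
  by rewrite -natr1 in t2; rewrite ler_norml; apply/andP; split; lra.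
have bx g : (orbit_annulus G o eps th n `&` [set x | phi x = (b1, b2)]) g ->
    [/\ G g, `|d1 g - b1%:R| <= 1 & `|d2 g - b2%:R| <= 1].
  move=> [[Gg _ /andP[_ gn] _] [e1 e2]].
  have [p1 p2] := d_le_product_dist g.
  split=> //; apply: near => //; try exact: mdist_ge0.
    exact: le_lt_trans gn.
  exact: le_lt_trans gn.
exists b1, b2, j, (f (Ordinal j0)).
have [_ n1 n2] := bx _ (hf (Ordinal j0)); have [An _] := hf (Ordinal j0).
split=> //.
  by exists f; split=> // i; exact: bx.
by rewrite card_prod !card_ord in kj.
Qed.

Lemma slope_0 (eta : R) (g : T) : 0 < eta -> `|slope o g - 0| <= atan eta ->
  d2 g <= eta * d1 g.
Proof.
move=> e0; rewrite subr0 /slope -/(d1 g) -/(d2 g); case: ifPn => [_ h|d0 h].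
  have := atan_ltpi2 eta; rewrite ltNge => /negP[].
  by apply: le_trans h; exact: ler_norm.
have d1p : 0 < d1 g by rewrite lt_neqAle eq_sym d0 mdist_ge0.
rewrite -ler_pdivrMr// leNgt; apply/negP => /lt_atan; rewrite ltNge => /negP[].
by apply: le_trans h; exact: ler_norm.
Qed.

Lemma slope_pi2 (eta : R) (g : T) : 0 < eta ->
  `|slope o g - pi / 2| <= pi / 2 - atan eta^-1 -> d1 g <= eta * d2 g.
Proof.
move=> e0; rewrite /slope -/(d1 g) -/(d2 g); case: ifPn => [/eqP -> _|d0 h].
  by rewrite mulr_ge0 ?(ltW e0)// mdist_ge0.
have d1p : 0 < d1 g by rewrite lt_neqAle eq_sym d0 mdist_ge0.
have : eta^-1 <= d2 g / d1 g.
  rewrite leNgt; apply/negP => /lt_atan; rewrite ltNge => /negP[].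
  by move: h; rewrite ler_norml => /andP[h _]; lra.
rewrite ler_pdivlMr// => /(ler_wpM2l (ltW e0)).
by rewrite mulrA divff ?gt_eqF// mul1r.
Qed.

(** The arctangent is continuous at [tan th], and [d1] stays away from [0]. *)
Lemma slope_near (th eps : R) : 0 < th < pi / 2 -> 0 < eps -> exists z : R,
  [/\ 0 < z, z <= cos th / 2 & forall (L : R) (g : T), 0 < L ->
    `|d1 g - L * cos th| <= z * L -> `|d2 g - L * sin th| <= z * L ->
    `|slope o g - th| <= eps].
Proof.
move=> /andP[th0 th1] e0.
have pi0 := pi_gt0 R.
have c0 : 0 < cos th by apply: cos_gt0_pihalf; apply/andP; split; lra.
have c1 := cos_le1 th. have s1 := sin_le1 th.
have s0 : 0 < sin th by apply: sin_gt0_pi; lra.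
have at_tan : atan (tan th) = th by apply: tanK; rewrite in_itv /=; apply/andP; split; lra.
have /cvgrPdist_le /(_ _ e0) := @continuous_atan R (tan th).
rewrite at_tan => /nbhs_ballP[del /= del0 hdel].
pose z := Num.min (cos th / 2) (del * cos th ^+ 2 / 8).
have z0 : 0 < z by rewrite lt_min !divr_gt0// mulr_gt0// exprn_gt0.
have z1 : z <= cos th / 2 by rewrite ge_min lexx.
have z2 : z <= del * cos th ^+ 2 / 8 by rewrite ge_min lexx orbT.
exists z; split=> // L g L0 hx hy; have /ler_normlP[x1 x2] := hx; have /ler_normlP[y1 y2] := hy.
have zL : z * L <= cos th / 2 * L by rewrite ler_wpM2r// ltW.
have d1L : cos th / 2 * L <= d1 g by lra.
have d1p : 0 < d1 g by apply: lt_le_trans d1L; rewrite mulr_gt0// divr_gt0.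
rewrite /slope -/(d1 g) -/(d2 g) gt_eqF// distrC; apply: hdel.
rewrite -ball_normE /=.
have -> : tan th - d2 g / d1 g =
   (sin th * d1 g - cos th * d2 g) / (cos th * d1 g).
  by rewrite /tan; field; rewrite !gt_eqF.
have den : 0 < cos th * d1 g by rewrite mulr_gt0.
rewrite normrM normfV (gtr0_norm den) ltr_pdivrMr//.
apply: (@le_lt_trans _ _ (2 * (z * L))).
  have a1 : `|sin th * (d1 g - L * cos th)| <= z * L.
    rewrite normrM (gtr0_norm s0) -[leRHS]mul1r; apply: ler_pM => //; exact: ltW.
  have a2 : `|cos th * (d2 g - L * sin th)| <= z * L.
    rewrite normrM (gtr0_norm c0) -[leRHS]mul1r; apply: ler_pM => //; exact: ltW.
  have -> : sin th * d1 g - cos th * d2 g =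
    sin th * (d1 g - L * cos th) - cos th * (d2 g - L * sin th) by ring.
  apply: (le_trans (ler_normB _ _)); lra.
have b1 : del * (cos th * (cos th / 2 * L)) <= del * (cos th * d1 g).
  by rewrite ler_wpM2l ?(ltW del0)// ler_wpM2l ?(ltW c0).
apply: lt_le_trans b1.
have b2 : z * L <= del * cos th ^+ 2 / 8 * L by rewrite ler_wpM2r// ltW.
have b3 : 0 < del * cos th ^+ 2 * L by rewrite !mulr_gt0// exprn_gt0.
rewrite expr2 in b2 b3; lra.
Qed.

End Boxes.

Section Concavity.
Variables (R : realType) (X1 X2 : metricType R).
Variable G : set ((X1 -> X1) * (X2 -> X2)).
Hypothesis pG : acts_properly G.
Variable o : X1 * X2.

Let d1 (g : (X1 -> X1) * (X2 -> X2)) : R := mdist o.1 (g.1 o.1).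
Let d2 (g : (X1 -> X1) * (X2 -> X2)) : R := mdist o.2 (g.2 o.2).
Let T := ((X1 -> X1) * (X2 -> X2))%type.

(** The pigeonhole loses a factor [n.+1 ^+ 2], which is absorbed by the loss of
    [eta] in the exponent. *)
Lemma rich_box (a eta eps th : R) (N : nat) : 0 < eta -> 0 < eps ->
  (a%:E < growth_rate G o th)%E ->
  exists (n k : nat) (a1 a2 : R) g, [/\ (N <= n)%N /\ (0 < n)%N, many G o k a1 a2 1,
    expR ((a - eta) * n%:R) <= k%:R, orbit_annulus G o eps th n g &
    `|d1 g - a1| <= 1 /\ `|d2 g - a2| <= 1].
Proof.
move=> eta0 eps0 ha; have [N1 hN1] := expR_dominates_square eta0.
have [n [k' [Nn n0 ek hk']]] := growth_rate_gt pG (maxn N N1) ha eps0.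
have {}ek := ltW ek.
have k'0 : (0 < k')%N by rewrite -(ltr0n R); apply: lt_le_trans ek; exact: expR_gt0.
have [a1 [a2 [k [g [hk kk Ag g1 g2]]]]] := annulus_box k'0 hk'.
exists n, k, a1%:R, a2%:R, g; split=> //.
  by split=> //; apply: leq_trans Nn; exact: leq_maxl.
have h1 := hN1 n (leq_trans (leq_maxr _ _) Nn).
have h2 : expR (a * n%:R) <= k%:R * n.+1%:R ^+ 2.
  by apply: (le_trans ek); rewrite -natrX -natrM ler_nat -mulnn.
have k0 : 0 <= k%:R :> R by [].
have e0 := expR_gt0 (eta * n%:R).
rewrite mulrBl expRD expRN ler_pdivrMr//.
by apply: (le_trans h2); rewrite ler_wpM2l.
Qed.

Lemma box_estimate (x y a1 a2 n eta : R) : 0 < eta -> 0 <= x -> 0 <= y ->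
  n - 1 <= x + y -> x < n -> y <= eta / 2 * x -> `|x - a1| <= 1 -> `|y - a2| <= 1 ->
  4 <= n * eta -> `|a1 - n| <= eta * n /\ `|a2| <= eta * n.
Proof.
move=> e0 x0 y0 h1 h2 h3 /ler_normlP[h4 h5] /ler_normlP[h6 h7] h8.
have h9 : eta / 2 * x <= eta / 2 * n by rewrite ler_wpM2l ?divr_ge0 ?ltW.
by rewrite !ler_norml; split; apply/andP; split; lra.
Qed.

Lemma rich_box_0 (a eta : R) (N : nat) : 0 < eta -> (a%:E < growth_rate G o 0)%E ->
  exists (n k : nat) (a1 a2 : R), [/\ (N <= n)%N /\ (0 < n)%N, many G o k a1 a2 1,
    expR ((a - eta) * n%:R) <= k%:R,
    `|a1 - n%:R| <= eta * n%:R & `|a2| <= eta * n%:R].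
Proof.
move=> eta0 ha; have e2 : 0 < eta / 2 by rewrite divr_gt0.
have at0 : 0 < atan (eta / 2) by rewrite -[X in X < _](@atan0 R) lt_atan.
have [M hM] := nat_above (4 / eta).
have [n [k [a1 [a2 [g [[Nn n0] hk ek [Gg _ /andP[A1 A2] As] [g1 g2]]]]]]] :=
  rich_box (maxn N M) eta0 at0 ha.
have sl := slope_0 e2 As; have [p1 p2] := d_le_product_dist o g.
have p3 := product_dist_le o g.
have hn : 4 <= n%:R * eta.
  rewrite -ler_pdivrMr//; apply: (le_trans hM); rewrite ler_nat.
  by apply: leq_trans Nn; exact: leq_maxr.
have [||||b1 b2] := box_estimate eta0 _ _ _ _ sl g1 g2 hn; try exact: mdist_ge0.
- exact: le_trans A1 p3.
- exact: le_lt_trans p1 A2.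
exists n, k, a1, a2; split=> //.
by split=> //; apply: leq_trans Nn; exact: leq_maxl.
Qed.

Lemma rich_box_pi2 (a eta : R) (N : nat) : 0 < eta -> (a%:E < growth_rate G o (pi / 2))%E ->
  exists (n k : nat) (a1 a2 : R), [/\ (N <= n)%N /\ (0 < n)%N, many G o k a1 a2 1,
    expR ((a - eta) * n%:R) <= k%:R,
    `|a1| <= eta * n%:R & `|a2 - n%:R| <= eta * n%:R].
Proof.
move=> eta0 ha; have e2 : 0 < eta / 2 by rewrite divr_gt0.
have at0 : 0 < pi / 2 - atan (eta / 2)^-1 by rewrite subr_gt0 atan_ltpi2.
have [M hM] := nat_above (4 / eta).
have [n [k [a1 [a2 [g [[Nn n0] hk ek [Gg _ /andP[A1 A2] As] [g1 g2]]]]]]] :=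
  rich_box (maxn N M) eta0 at0 ha.
have sl := slope_pi2 e2 As; have [p1 p2] := d_le_product_dist o g.
have p3 := product_dist_le o g; rewrite addrC in p3.
have hn : 4 <= n%:R * eta.
  rewrite -ler_pdivrMr//; apply: (le_trans hM); rewrite ler_nat.
  by apply: leq_trans Nn; exact: leq_maxr.
have [||||b1 b2] := box_estimate eta0 _ _ _ _ sl g2 g1 hn; try exact: mdist_ge0.
- exact: le_trans A1 p3.
- exact: le_lt_trans p2 A2.
exists n, k, a1, a2; split=> //.
by split=> //; apply: leq_trans Nn; exact: leq_maxl.
Qed.

(** Here [p n] and [q m] are the multiples of the box sizes just below [L co] and
    [L si]. The defects of the boxes, the additive error [D] of each product and
    the rounding are all proportional to [eta L]: each contributes at most
    [eta L], and there are five of them. *)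
Lemma word_position (L co si n m p q a1 a2 b1 b2 D eta x y : R) :
  0 < eta -> 0 <= L -> 0 <= co <= 1 -> 0 <= si <= 1 -> 1 <= n -> 1 <= m ->
  0 <= p -> 0 <= q ->
  p * n <= L * co -> L * co <= p * n + n -> q * m <= L * si -> L * si <= q * m + m ->
  `|a1 - n| <= eta * n -> `|a2| <= eta * n -> `|b1| <= eta * m -> `|b2 - m| <= eta * m ->
  0 <= D -> D <= eta * n -> D <= eta * m -> n <= eta * L -> m <= eta * L ->
  `|x - (p * a1 + q * b1)| <= (p + q) * D -> `|y - (p * a2 + q * b2)| <= (p + q) * D ->
  `|x - L * co| <= 5 * eta * L /\ `|y - L * si| <= 5 * eta * L.
Proof.
move=> e0 L0 /andP[c0 c1] /andP[s0 s1] n1 m1 p0 q0 pn pn' qm qm' ha1 ha2 hb1 hb2.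
move=> D0 Dn Dm nL mL hx hy.
have pL : p * n <= L by apply: (le_trans pn); rewrite ler_piMr.
have qL : q * m <= L by apply: (le_trans qm); rewrite ler_piMr.
have epL : eta * (p * n) <= eta * L by rewrite ler_wpM2l ?(ltW e0).
have eqL : eta * (q * m) <= eta * L by rewrite ler_wpM2l ?(ltW e0).
have pD : p * D <= eta * (p * n).
  by have := ler_wpM2l p0 Dn; rewrite mulrCA.
have qD : q * D <= eta * (q * m).
  by have := ler_wpM2l q0 Dm; rewrite mulrCA.
have scale r (z w : R) : 0 <= r -> `|z| <= eta * w -> `|r * z| <= eta * (r * w).
  move=> r0 h; rewrite normrM (ger0_norm r0).
  by have := ler_wpM2l r0 h; rewrite mulrCA.
have ka1 := scale _ _ _ p0 ha1; have ka2 := scale _ _ _ p0 ha2.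
have kb1 := scale _ _ _ q0 hb1; have kb2 := scale _ _ _ q0 hb2.
rewrite mulrBr in ka1; rewrite mulrBr in kb2.
move: hx hy ka1 ka2 kb1 kb2; rewrite mulrDl.
move=> /ler_normlP[u1 u2] /ler_normlP[u3 u4] /ler_normlP[u5 u6] /ler_normlP[u7 u8].
move=> /ler_normlP[v1 v2] /ler_normlP[v3 v4].
clear scale ha1 ha2 hb1 hb2.
by rewrite !ler_norml; split; apply/andP; split; lra.
Qed.

Lemma expR_beats_linear (s c C : R) : 0 < s -> 0 <= c -> 0 <= C -> exists N : nat,
  forall L : R, N%:R <= L -> c * (C * L + 3) < expR (s * L).
Proof.
move=> s0 c0 C0; have s20 : 0 < s ^+ 2 by rewrite exprn_gt0.
have [Z [Z0 ZE]] : exists Z, 0 <= Z /\ s ^+ 2 * Z = 4 * (c * (C + 3)).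
  exists (4 * (c * (C + 3)) / s ^+ 2); split; last by rewrite [LHS]mulrC divfK ?gt_eqF.
  by rewrite divr_ge0 ?sqr_ge0// !mulr_ge0// addr_ge0.
have [N hN] := nat_above (Z + 1); exists N => L NL.
have L1 : 1 <= L by lra.
have hL : 4 * (c * (C + 3)) < s ^+ 2 * L by rewrite -ZE ltr_pM2l//; lra.
have h : (s * L / 2) ^+ 2 <= expR (s * L).
  have -> : expR (s * L) = expR (s * L / 2) ^+ 2.
    by rewrite -expRM_natl; congr expR; field.
  have sL : 0 <= s * L by apply: mulr_ge0; lra.
  rewrite ler_pXn2r ?nnegrE ?expR_ge0 ?divr_ge0//.
  by apply: le_trans (expR_ge1Dx _); rewrite lerDr.
apply: lt_le_trans h.
have -> : (s * L / 2) ^+ 2 = s ^+ 2 * L * L / 4 by field.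
have h1 : c * (C * L + 3) <= c * (C + 3) * L.
  rewrite -mulrA; apply: ler_wpM2l => //; lra.
apply: (le_lt_trans h1).
have h2 : 4 * (c * (C + 3)) * L < s ^+ 2 * L * L by rewrite ltr_pM2r//; lra.
lra.
Qed.

Lemma word_count (K n k p a eta w : R) (pn : nat) : 1 <= K -> 0 < n -> p = pn%:R ->
  expR ((a - eta) * n) <= k -> K <= expR (eta * n) -> 0 <= a - 2 * eta -> w <= p * n ->
  expR ((a - 2 * eta) * w) <= (k / K) ^+ pn.
Proof.
move=> K1 n0 -> ek eK a0 wpn.
have K0 : 0 < K by lra.
have h : expR ((a - 2 * eta) * n) <= k / K.
  rewrite ler_pdivlMr//; apply: (@le_trans _ _ (expR ((a - 2 * eta) * n) * expR (eta * n))).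
    by rewrite ler_wpM2l ?expR_ge0.
  by rewrite -expRD; apply: le_trans ek; rewrite ler_expR; lra.
apply: (@le_trans _ _ (expR ((a - 2 * eta) * n) ^+ pn)).
  rewrite -expRM_natl ler_expR mulrCA; apply: ler_wpM2l => //.
by rewrite lerXn2r ?nnegrE ?expR_ge0// (le_trans _ h)// expR_ge0.
Qed.

End Concavity.

(** * Concavity of the growth rate *)

Section SlopeConcavity.
Variables (R : realType) (X1 X2 : metricType R).
Variable G : set ((X1 -> X1) * (X2 -> X2)).
Hypothesis pG : acts_properly G.
Variable o : X1 * X2.

Let d1 (g : (X1 -> X1) * (X2 -> X2)) : R := mdist o.1 (g.1 o.1).
Let d2 (g : (X1 -> X1) * (X2 -> X2)) : R := mdist o.2 (g.2 o.2).
Let T := ((X1 -> X1) * (X2 -> X2))%type.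

(** An upper bound for the number of elements in each annulus becomes one for a
    set that is covered by at most [M + 1] annuli. *)
Lemma annuli_bound (eps th t M : R) (N : nat) (S : set T) (k : nat) : 0 <= t -> 0 <= M ->
  (forall n k : nat, (N <= n)%N -> has_many (orbit_annulus G o eps th n) k ->
     k%:R <= expR (t * n%:R)) ->
  (forall g, S g -> [/\ G g, act g o <> o, N%:R <= product_dist o (act g o) <= M &
     `|slope o g - th| <= eps]) ->
  has_many S k -> k%:R <= (M + 1) * expR (t * (M + 1)).
Proof.
move=> t0 M0 hA hS hk.
have rhs0 : 0 <= (M + 1) * expR (t * (M + 1)) by rewrite mulr_ge0 ?expR_ge0// addr_ge0.
have [->|k0] := posnP k; first exact: rhs0.
pose pd (g : T) := product_dist o (act g o).
pose phi (g : T) : 'I_(Num.truncn M).+1 := inord (Num.truncn (pd g)).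
have [b [j [j0 [f [finj hf]] kj]]] := has_many_pigeonhole phi k0 hk.
have hb i : [/\ b%:R <= pd (f i), pd (f i) < b.+1%:R & N%:R <= pd (f i)].
  have [/hS[_ _ /andP[h1 h2] _] <-] := hf i.
  have pd0 : 0 <= pd (f i) by exact: sqrtr_ge0.
  have /andP[t1 t2] := truncn_itv pd0.
  by rewrite /phi inordK ?ltnS ?le_truncn.
have hj : has_many (orbit_annulus G o eps th b.+1) j.
  exists f; split=> // i; have [/hS[h1 h2 h3 h4] _] := hf i; split=> //.
  by have [b1 b2 _] := hb i; rewrite -natr1 addrK b1 natr1.
have Nb : (N <= b.+1)%N.
  have [_ b2 b3] := hb (Ordinal j0).
  by rewrite -(ler_nat R); apply: ltW; exact: le_lt_trans b3 b2.
have := hA _ _ Nb hj => jb.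
have bM : b%:R <= M.
  have := ltn_ord b; rewrite ltnS -(ler_nat R) => /le_trans; apply.
  by have /andP[] := truncn_itv M0.
have MM : (Num.truncn M).+1%:R <= M + 1.
  by rewrite -natr1 lerD2r; have /andP[] := truncn_itv M0.
rewrite card_ord in kj.
apply: (@le_trans _ _ (j%:R * (Num.truncn M).+1%:R)); first by rewrite -natrM ler_nat.
rewrite mulrC; apply: ler_pM => //; apply: (le_trans jb).
by rewrite ler_expR ler_wpM2l// -natr1 lerD2r.
Qed.

Lemma common_small (a b c e : R) : 0 < a -> 0 < b -> 0 < c -> 0 < e ->
  exists x : R, [/\ 0 < x, x <= a, x <= b, x <= c & x <= e].
Proof.
move=> a0 b0 c0 e0; exists (Num.min (Num.min a b) (Num.min c e)).
by rewrite !lt_min !ge_min a0 b0 c0 e0 !lexx !orbT.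
Qed.

Lemma common_large (a b c e : R) : exists x : R, [/\ a <= x, b <= x, c <= x & e <= x] /\ 0 < x.
Proof.
exists (Num.max (Num.max (Num.max a b) (Num.max c e)) 1).
by rewrite !le_max !lt_max !lexx ltr01 !orbT.
Qed.

Lemma radius_estimate (L co si eta x y : R) : 0 <= L -> 0 <= eta ->
  0 <= co <= 1 -> 0 <= si <= 1 -> co ^+ 2 + si ^+ 2 = 1 -> 0 <= x -> 0 <= y ->
  `|x - L * co| <= 5 * eta * L -> `|y - L * si| <= 5 * eta * L ->
  x ^+ 2 + y ^+ 2 <= (L * (1 + 10 * eta)) ^+ 2.
Proof.
move=> L0 e0 /andP[c0 c1] /andP[s0 s1] cs x0 y0 /ler_normlP[_ hx] /ler_normlP[_ hy].
have sqr (u v : R) : 0 <= u -> 0 <= v -> u - L * v <= 5 * eta * L ->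
    u ^+ 2 <= (L * (v + 5 * eta)) ^+ 2.
  move=> u0 v0 h; have v5 : 0 <= L * (v + 5 * eta) by rewrite mulr_ge0// addr_ge0// mulr_ge0.
  by rewrite ler_pXn2r// ?nnegrE//; lra.
apply: (le_trans (lerD (sqr _ _ x0 c0 hx) (sqr _ _ y0 s0 hy))).
have -> : (L * (co + 5 * eta)) ^+ 2 + (L * (si + 5 * eta)) ^+ 2 =
  L ^+ 2 * ((co ^+ 2 + si ^+ 2) + 10 * eta * (co + si) + 50 * eta ^+ 2) by ring.
rewrite cs exprMn ler_wpM2l ?sqr_ge0//.
have : eta * (co + si) <= eta * 2 by rewrite ler_wpM2l//; lra.
have := sqr_ge0 eta; lra.
Qed.

Lemma half_lower (L co eta z x : R) : 0 <= L -> 5 * eta <= z -> z <= co / 2 ->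
  `|x - L * co| <= 5 * eta * L -> co / 2 * L <= x.
Proof.
move=> L0 h1 h2 /ler_normlP[h3 _].
have := ler_wpM2r L0 (le_trans h1 h2); lra.
Qed.

Lemma rounding_loss (L x y w eta : R) :
  L * x <= y + w -> w <= eta * L -> L * (x - eta) <= y.
Proof. lra. Qed.

Hypothesis words : exists K D : R, 1 <= K /\ 0 <= D /\
  forall n a1 a2 m b1 b2, many G o n a1 a2 1 -> many G o m b1 b2 1 ->
  forall p q : nat, exists k : nat,
    many G o k (p%:R * a1 + q%:R * b1) (p%:R * a2 + q%:R * b2) ((p + q)%:R * D) /\
    (n%:R / K) ^+ p * (m%:R / K) ^+ q <= k%:R.

(** If the growth rate at [th] were below [t], the annuli would contain at most
    [expR (t n)] elements of slope near [th]. The words of length [L] in the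
    direction [th] number at least about [expR (L (a cos th + b sin th))], up to
    errors proportional to [eta], which is more than the linearly many annuli in
    which they lie can contain when [L] is large. *)
Lemma growth_concave (a b th t : R) : 0 < th < pi / 2 -> 0 < a -> 0 < b ->
  (a%:E < growth_rate G o 0)%E -> (b%:E < growth_rate G o (pi / 2))%E ->
  0 <= t -> t < a * cos th + b * sin th -> (t%:E <= growth_rate G o th)%E.
Proof.
move=> hth a0 b0 ha hb t0 ht; rewrite leNgt; apply/negP => /(growth_rate_lt pG)[eps [N0 [eps0 hN0]]].
have [K [D [K1 [D0 hw]]]] := words.
have /andP[th0 th1] := hth; have pi0 := pi_gt0 R.
have c0 : 0 < cos th by apply: cos_gt0_pihalf; apply/andP; split; lra.
have s0 : 0 < sin th by apply: sin_gt0_pi; lra.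
have c1 := cos_le1 th. have s1 := sin_le1 th.
have cs := cos2Dsin2 th.
have [z [z0 zc hz]] := slope_near o hth eps0.
pose co := cos th; pose si := sin th.
rewrite -/co in c0 c1 zc cs; rewrite -/si in s0 s1 cs.
rewrite -/co -/si in ht.
pose Del := a * co + b * si - t.
have Del0 : 0 < Del by rewrite subr_gt0.
(* The total loss in the exponent is at most eta * Q. *)
pose Q := a + b + 4 + 10 * t.
have Q0 : 0 < Q by rewrite /Q; lra.
have [eta [e0 ea eb ez eD]] : exists x : R, [/\ 0 < x, x <= a / 2, x <= b / 2, x <= z / 5 &
    x <= Del / (2 * Q)].
  by apply: common_small; rewrite divr_gt0// mulr_gt0.
have ez5 : 5 * eta <= z by rewrite mulrC -ler_pdivlMr.
have eQ : eta * Q <= Del / 2.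
  by move: eD; rewrite ler_pdivlMr ?mulr_gt0//; lra.
pose C := 1 + 10 * eta.
pose s := (a - 2 * eta) * (co - eta) + (b - 2 * eta) * (si - eta) - t * C.
have s_gt0 : 0 < s.
  have ce : eta * co <= eta by rewrite ler_piMr// ltW.
  have se : eta * si <= eta by rewrite ler_piMr// ltW.
  have ee : 0 <= eta ^+ 2 by exact: sqr_ge0.
  have -> : s = Del - eta * (a + b + 10 * t) - 2 * (eta * co) - 2 * (eta * si) + 4 * eta ^+ 2.
    by rewrite /s /C /Del; ring.
  have : eta * Q = eta * (a + b + 10 * t) + 4 * eta by rewrite /Q; ring.
  lra.
have C0 : 0 <= C by rewrite /C; lra.
have [N2 hN2] := expR_beats_linear s_gt0 (expR_ge0 t) C0.
have [N3 hN3] := nat_above (D / eta).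
have [N4 hN4] := nat_above (K / eta).
have big (n : nat) : (maxn N3 N4 <= n)%N -> D <= eta * n%:R /\ K <= expR (eta * n%:R).
  rewrite geq_max => /andP[n3 n4]; split.
    by rewrite mulrC -ler_pdivrMr// (le_trans hN3)// ler_nat.
  apply: le_trans (expR_ge1Dx _).
  have : K <= eta * n%:R by rewrite mulrC -ler_pdivrMr// (le_trans hN4)// ler_nat.
  lra.
have [n [k1 [a1 [a2 [[/big[nD nK] n0] hk1 ek1 ha1 ha2]]]]] := rich_box_0 pG (maxn N3 N4) e0 ha.
have [m [k2 [b1 [b2 [[/big[mD mK] m0] hk2 ek2 hb1 hb2]]]]] := rich_box_pi2 pG (maxn N3 N4) e0 hb.
have n1 : 1 <= n%:R :> R by rewrite ler1n.
have m1 : 1 <= m%:R :> R by rewrite ler1n.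
have nR : 0 < n%:R :> R by rewrite ltr0n.
have mR : 0 < m%:R :> R by rewrite ltr0n.
have [L [L2 Ln Lm LN L0]] : exists L : R, [/\ N2%:R <= L, n%:R <= eta * L, m%:R <= eta * L,
    N0%:R <= co / 2 * L & 0 < L].
  have [L [[h1 h2 h3 h4] h5]] := common_large N2%:R (n%:R / eta) (m%:R / eta) (N0%:R / (co / 2)).
  have c2 : 0 < co / 2 by rewrite divr_gt0.
  by exists L; split=> //; rewrite mulrC -ler_pdivrMr.
pose p := Num.truncn (L * co / n%:R); pose q := Num.truncn (L * si / m%:R).
have trunc (x y : R) : 0 <= x -> 0 < y ->
    (Num.truncn (x / y))%:R * y <= x /\ x <= (Num.truncn (x / y))%:R * y + y.
  move=> x0 y0; have /andP[h1 h2] := truncn_itv (divr_ge0 x0 (ltW y0)).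
  rewrite -ler_pdivlMr//; split=> //.
  by move: h2; rewrite -natr1 ltr_pdivrMr// => /ltW; rewrite mulrDl mul1r.
have [p1 p2] : p%:R * n%:R <= L * co /\ L * co <= p%:R * n%:R + n%:R.
  by apply: trunc => //; rewrite mulr_ge0 ?ltW.
have [q1 q2] : q%:R * m%:R <= L * si /\ L * si <= q%:R * m%:R + m%:R.
  by apply: trunc => //; rewrite mulr_ge0 ?ltW.
have [k [hk kk]] := hw _ _ _ _ _ _ hk1 hk2 p q.
have c01 : 0 <= co <= 1 by rewrite (ltW c0).
have s01 : 0 <= si <= 1 by rewrite (ltW s0).
pose M := L * C.
have M0 : 0 <= M by rewrite mulr_ge0// ltW.
have upper : k%:R <= (M + 1) * expR (t * (M + 1)).
  pose S := [set g : T | [/\ G g,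
    `|d1 g - (p%:R * a1 + q%:R * b1)| <= (p + q)%:R * D &
    `|d2 g - (p%:R * a2 + q%:R * b2)| <= (p + q)%:R * D]].
  have hS : has_many S k by exact: hk.
  apply: (annuli_bound t0 M0 hN0 _ hS) => g [Gg g1 g2].
  rewrite natrD in g1 g2.
  have [h1 h2] := word_position e0 (ltW L0) c01 s01 n1 m1 (ler0n _ _) (ler0n _ _)
    p1 p2 q1 q2 ha1 ha2 hb1 hb2 D0 nD mD Ln Lm g1 g2.
  have zL : 5 * eta * L <= z * L by rewrite ler_wpM2r ?(ltW L0).
  have sl := hz L g L0 (le_trans h1 zL) (le_trans h2 zL).
  have d1L := half_lower (ltW L0) ez5 zc h1.
  have d1p : 0 < d1 g by apply: lt_le_trans d1L; rewrite mulr_gt0// divr_gt0.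
  have [pd1 _] := d_le_product_dist o g; rewrite -/(d1 g) in pd1.
  split=> //.
    move=> go; move: d1p; rewrite /d1.
    have -> : g.1 o.1 = o.1 by exact: (congr1 fst go).
    by rewrite mdistxx ltxx.
  apply/andP; split; first by apply: le_trans pd1; exact: le_trans LN d1L.
  apply: norm2_le => //.
  by apply: (radius_estimate (ltW L0) (ltW e0) c01 s01 cs) => //; exact: mdist_ge0.
have ae : 0 <= a - 2 * eta by rewrite subr_ge0 mulrC -ler_pdivlMr.
have be : 0 <= b - 2 * eta by rewrite subr_ge0 mulrC -ler_pdivlMr.
have w1 := rounding_loss p2 Ln; have w2 := rounding_loss q2 Lm.
have l1 := word_count K1 nR erefl ek1 nK ae w1.
have l2 := word_count K1 mR erefl ek2 mK be w2.
have lower : expR ((a - 2 * eta) * (L * (co - eta))) * expR ((b - 2 * eta) * (L * (si - eta)))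
    <= k%:R.
  by apply: le_trans kk; apply: ler_pM; rewrite ?expR_ge0.
have := le_trans lower upper.
rewrite -expRD leNgt => /negP; apply.
have -> : (a - 2 * eta) * (L * (co - eta)) + (b - 2 * eta) * (L * (si - eta)) =
  s * L + t * M by rewrite /s /M; ring.
have -> : t * (M + 1) = t + t * M by ring.
rewrite !expRD mulrA ltr_pM2r ?expR_gt0//.
apply: le_lt_trans (hN2 L L2); rewrite mulrC ler_wpM2l ?expR_ge0//.
by rewrite /M mulrC lerD2l ler1n.
Qed.

End SlopeConcavity.

(** With [b] a positive real below [y], the slope of the vector [(x, b)] is the
    best one: there [x cos th + b sin th] is the length of the vector, which is
    more than [x]. When [x] is infinite any interior slope gives an infinite
    bound. *)
Lemma interior_beats_endpoint (R : realType) (x y : \bar R) (g : R -> \bar R) :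
  (0 < x)%E -> (0 < y)%E ->
  (forall a b th t : R, 0 < th < pi / 2 -> 0 < a -> 0 < b ->
     (a%:E < x)%E -> (b%:E < y)%E -> 0 <= t -> t < a * cos th + b * sin th ->
     (t%:E <= g th)%E) ->
  exists2 th : R, 0 < th < pi / 2 & (x <= g th)%E.
Proof.
move=> x0 y0 hg; have [b /andP[b0 by']] := ereal_real_between y0.
rewrite lte_fin in b0.
have atanI (z : R) : 0 < z -> 0 < atan z < pi / 2.
  by move=> z0; rewrite atan_ltpi2 andbT -[X in X < _](@atan0 R) lt_atan.
have cos0 (z : R) : 0 < cos (atan z).
  by rewrite cos_atan invr_gt0 sqrtr_gt0 ltr_wpDr ?sqr_ge0.
have sinE (z : R) : sin (atan z) = z * cos (atan z).
  have : sin (atan z) = tan (atan z) * cos (atan z) by rewrite /tan divfK// gt_eqF.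
  by rewrite atanK.
case: x x0 hg => [r| |] // x0 hg; last first.
  exists (atan 1); first exact: atanI.
  rewrite leye_eq; apply/eqP/eqyP => A A0.
  have ch := cos0 1; apply: (hg (A / cos (atan 1)) b) => //.
  - exact: atanI.
  - by rewrite divr_gt0.
  - by rewrite ltry.
  - exact: ltW.
  by rewrite divfK ?gt_eqF// ltrDl mulr_gt0// sinE mul1r.
rewrite lte_fin in x0; pose z := b / r.
have z0 : 0 < z by rewrite divr_gt0.
have zr : z * r = b by rewrite /z divfK ?gt_eqF.
exists (atan z); first exact: atanI.
set th := atan z; pose S := r * cos th + b * sin th.
have rS : r < S.
  have sq : 1 < Num.sqrt (1 + z ^+ 2).
    have z1 : 1 < 1 + z ^+ 2 by rewrite ltrDl exprn_gt0.
    by rewrite -[X in X < _]sqrtr1 ltr_sqrt// (lt_trans ltr01 z1).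
  have s2 : Num.sqrt (1 + z ^+ 2) ^+ 2 = 1 + z ^+ 2.
    by rewrite sqr_sqrtr// addr_ge0 ?sqr_ge0.
  have -> : S = r * Num.sqrt (1 + z ^+ 2).
    rewrite /S sinE -zr /th cos_atan; set w := Num.sqrt _ in sq s2 *.
    have w0 : 0 < w by apply: lt_trans sq.
    have -> : r / w + z * r * (z / w) = r * (1 + z ^+ 2) / w by ring.
    by rewrite -s2 expr2 mulrA mulfK// gt_eqF.
  by rewrite ltr_pMr.
have ch : 0 < cos th by exact: cos0.
have c1 := cos_le1 th.
pose e := Num.min ((S - r) / 2) (r / 2).
have e0 : 0 < e by rewrite lt_min !divr_gt0// subr_gt0.
have e1 : e <= (S - r) / 2 by rewrite ge_min lexx.
have e2 : e <= r / 2 by rewrite ge_min lexx orbT.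
apply: (hg (r - e) b) => //.
- exact: atanI.
- lra.
- by rewrite lte_fin gtrBl.
- exact: ltW.
have : e * cos th <= e by rewrite ler_piMr// ltW.
rewrite mulrBl; move: rS e1; rewrite /S; lra.
Qed.

Theorem corollary1p12 (R : realType) (X1 X2 : metricType R) (o : X1 * X2)
    (G : set ((X1 -> X1) * (X2 -> X2)))
    (hX1 : Hadamard X1) (pX1 : proper_space X1)
    (hX2 : Hadamard X2) (pX2 : proper_space X2)
    (hG : isometry_subgroup G) (pG : acts_properly G)
    (indep : exists g h : (X1 -> X1) * (X2 -> X2),
        [/\ G g, G h,
            independent_rank_one g.1 h.1 & independent_rank_one g.2 h.2])
    (pos : forall theta : R, (0 <= theta <= pi / 2)%R ->
        (0 < growth_rate G o theta)%E) :
  exists theta_star : R,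
    (0 < theta_star < pi / 2)%R /\
    (forall theta : R, (0 <= theta <= pi / 2)%R ->
       (growth_rate G o theta <= growth_rate G o theta_star)%E).
Proof.
have [_ geo1 cat1] := hX1; have [_ geo2 cat2] := hX2.
have CN1 := CAT0_CN geo1 cat1; have CN2 := CAT0_CN geo2 cat2.
have [g [h [Gg Gh ind1 ind2]]] := indep.
have [I [lam [C [Glam lamP]]]] :=
  generic_product hG CN1 geo1 pX1 CN2 geo2 pX2 o Gg Gh ind1 ind2.
have words := count_words hG pG CN1 geo1 CN2 geo2 Glam lamP.
have pi2 : 0 < pi / 2 :> R by rewrite divr_gt0// pi_gt0.
have pos0 : (0 < growth_rate G o 0)%E by apply: pos; rewrite lexx ltW.
have pos1 : (0 < growth_rate G o (pi / 2))%E by apply: pos; rewrite lexx ltW.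
have conc := growth_concave pG words.
have [t0 t0I max0] := growth_rate_attains_max pG o.
suff [t tI ht] : exists2 t : R, 0 < t < pi / 2 & (growth_rate G o t0 <= growth_rate G o t)%E.
  exists t; split; first exact: tI.
  by move=> theta hth; apply: (le_trans (max0 theta hth)); exact: ht.
move: t0I; rewrite le_eqVlt => /andP[/predU1P[<- _|t00]].
  apply: (interior_beats_endpoint pos0 pos1) => a b th t hth a0 b0 ha hb tp ht.
  exact: conc hth a0 b0 ha hb tp ht.
rewrite le_eqVlt => /predU1P[->|t01]; last first.
  by exists t0; [rewrite t00|exact: lexx].
have [th hth hle] : exists2 th : R, 0 < th < pi / 2 &
    (growth_rate G o (pi / 2) <= growth_rate G o (pi / 2 - th))%E.
  apply: (interior_beats_endpoint pos1 pos0) => a b th t /andP[h0 h1] a0 b0 ha hb tp ht.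
  apply: (conc b a _ t _ b0 a0 hb ha tp); first by rewrite subr_gt0 h1 gtrBl.
  by rewrite -cosN -[sin _]opprK -sinN opprB cosBpihalf sinBpihalf opprK addrC.
exists (pi / 2 - th); last exact: hle.
by have /andP[h0 h1] := hth; rewrite subr_gt0 h1 gtrBl.
Qed.
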